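(* Suppose that for each $i\in\mathcal A$ there is $B_i\ge0$ such that for all $s\in\mathcal S$, every $\zeta_i\in\partial_x[U_i^{DR}(x,s_{-i})]|_{s_i}$ satisfies $\|\zeta_i\|\le B_i$. Suppose moreover that $\mathcal G^{DR}$ has amicable supergradients with factors of amicability $\{c_i\}_{i\in\mathcal A}$ (and associated radii $d_i>0$). With $d_{\min}=\min_{i\in\mathcal A}d_i$, choose $\mu_i\in(0,\infty)$ for all $i\in\mathcal A$ and $$\alpha_i\in\Big(0,\min\Big\{\frac{d_{\min}}{D_i},\frac12\Big\}\Big],\quad\forall i\in\mathcal A.$$ For all $i\in\mathcal A$ choose $\varrho_i\in(1,\infty)$ and suppose $$\lambda_i\in\begin{cases}\Big(\dfrac1{\varrho_i\mu_ic_i},\dfrac1{\mu_ic_i}\Big), & c_i>0,\\[2mm]\Big(\dfrac1{\varrho_i\mu_i},\infty\Big), & \text{otherwise}.\end{cases}$$ Define $\omega(\cdot)=d(\cdot,\mathcal{NE}(\mathcal G^{DR}))$, the distance to the set of Nash equilibria of $\mathcal G^{DR}$, and let $\bar\alpha=\max_{i}\alpha_i$, $\bar\mu=\max_i\mu_i$. Let $s(t)$ be a trajectory, from initial condition $\{s_i(0)=s_i(-1)\in\mathcal S_i\}_{i\in\mathcal A}$, of the dynamics $$s_i(t+1)=s_i(t)+\alpha_i[\pi_i(\varphi_i(t))-s_i(t)],\qquad \varphi_i(t)=\mu_iv_i(s(t))-\frac1{\lambda_i}[s_i(t)-s_i(t-1)],\quad i\in\mathcal A.$$ Then there exist functions $\beta_1\in\mathcal{KL}$,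 $\gamma_1\in\mathcal K$ and a continuous function $\rho_1:[0,0.5]\times\mathbb R_{\ge0}\to\mathbb R_{\ge0}$ such that (for all $t\in\mathbb Z_{\ge 0}$) $$\omega(s(t))\le\max\{\beta_1(\omega(s(0)),t),\ \gamma_1(K\rho_1(\bar\alpha,\bar\mu))\},$$ where the constant $K$ depends only on $\{D_i,B_i,c_i,\varrho_i\}_{i\in\mathcal A}$. Moreover, $\rho_1$ is strictly increasing with respect to both its arguments and $\rho_1(x,y)\to0$ as $(x,y)\to0$.
   Context: Game: $\mathcal A=\{1,\dots,n\}$; each $\mathcal S_i\subseteq\mathbb R^{n_i}$ is non-empty, convex and compact with diameter $D_i$; $\mathcal S=\times_i\mathcal S_i$. The utility $U_i(s_i,s_{-i};\xi)$ is continuous, concave in $s_i$, and $L_i$-Lipschitz in $\xi\in\Xi$, $\Xi\subset\mathbb R^m$ compact. $\mathcal M(\Xi)$ is the set of probability distributions on $\Xi$ with bounded first and second moments. With i.i.d. samples $\hat\xi^{(1)},\dots,\hat\xi^{(N)}$ and stacked observation function $h:\mathbb R^m\to\mathbb R^m$, $\hat{\mathbb P}_h^N=\frac1N\sum_k\delta_{h(\hat\xi^{(k)})}$; $\mathcal B_\varepsilon(\mathbb P)=\{\mathbb Q\in\mathcal M(\Xi):d_W(\mathbb Q,\mathbb P)\le\varepsilon\}$ for $\mathbb P\in\mathcal M(\Xi)$, where $d_W$ is the 1-Wasserstein distance with cost $\|\cdot\|_1$. $U_i^{DR}(s)=\inf_{\mathbb Q\in\mathcal B_{\epsilon_i}(\hat{\mathbb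 P}_h^N)}\mathbb E_{\xi\sim\mathbb Q}[U_i(s;\xi)]$ with $\epsilon_i\ge0$; $\mathcal G^{DR}=\langle\mathcal A,\{\mathcal S_i\},\{U_i^{DR}\}\rangle$; $\mathcal{NE}(\mathcal G^{DR})$ is the set of $s^\star\in\mathcal S$ with $U_i^{DR}(s_i^\star,s_{-i}^\star)\ge U_i^{DR}(s_i,s_{-i}^\star)$ for all $s_i\in\mathcal S_i$, $i\in\mathcal A$. Supergradients: $\partial_x[U_i^{DR}(x,s_{-i})]|_{s_i}$ is the set of supergradients of the concave function $U_i^{DR}(\cdot,s_{-i})$ at $s_i$ ($\zeta$ with $f(y)\le f(x)+\zeta^\top(y-x)$ for all $y$ in the domain). Amicable supergradients: for each $i\in\mathcal A$ there are $d_i>0$ and $c_i\in\mathbb R$ such that for all $(s_i,s_{-i})\in\mathcal S$ and all $(\bar s_i,\bar s_{-i})\in\mathcal S$ within distance $d_i$ of $(s_i,s_{-i})$ there exist $\zeta_i^1\in\partial_x[U_i^{DR}(x,s_{-i})]|_{s_i}$, $\zeta_i^2\in\partial_x[U_i^{DR}(x,\bar s_{-i})]|_{s_i}$, $\zeta_i^3\in\partial_x[U_i^{DR}(x,s_{-i})]|_{\bar s_i}$ with $$[\zeta_i^2-\zeta_i^1]^\top[\bar s_i-s_i]-[\zeta_i^3-\zeta_i^1]^\top[\bar s_i-s_i]\le c_i\|\bar s_i-s_i\|^2 .$$ $\{c_i\}$ are the factors of amicability. Dynamics: $\pi_i(\varphi_i)\in\arg\max_{x\in\mathcal S_i}x^\top\varphi_i$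 is a selection of a maximizer; $v_i(s)$ is the $\zeta_i$-component of the optimizer (treated as unique in the paper) of $\min_{\zeta_i,z}\|-\zeta_i+z\|^2$ subject to $\zeta_i\in\partial_x[U_i^{DR}(x,s_{-i})]|_{s_i}$ and $z\in N_{\mathcal S_i}(s_i)=\{z:z^\top(y-s_i)\le0\ \forall y\in\mathcal S_i\}$. Comparison functions: $\sigma:\mathbb R_{\ge0}\to\mathbb R_{\ge0}$ continuous is class $\mathcal K$ if strictly increasing with $\sigma(0)=0$; continuous $\beta:\mathbb R_{\ge0}^2\to\mathbb R_{\ge0}$ is class $\mathcal{KL}$ if $\beta(\cdot,y)\in\mathcal K$ for every $y$ and, for every $x$, $\beta(x,\cdot)$ is decreasing with $\beta(x,y)\to0$ as $y\to\infty$. *)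

(* Defs.v *)
From HB Require Import structures.
From mathcomp Require Import all_boot all_order all_algebra.
From mathcomp Require Import all_classical all_reals all_analysis.

Set Implicit Arguments.
Unset Strict Implicit.
Unset Printing Implicit Defensive.

Import Order.TTheory GRing.Theory Num.Theory.
Import numFieldNormedType.Exports.

Local Open Scope classical_set_scope.
Local Open Scope ring_scope.

(* The library norm on 'rV[R]_k is the sup norm; the norms used here are
   the Euclidean one and the 1-norm. *)
Section euclidean.
Variable R : realType.

Definition dot k (x y : 'rV[R]_k) : R := \sum_(j < k) x 0 j * y 0 j.

Definition norm2 k (x : 'rV[R]_k) : R := Num.sqrt (dot x x).

Definition norm1 k (x : 'rV[R]_k) : R := \sum_(j < k) `|x 0 j|.

Definition diameter k (A : set 'rV[R]_k) : R :=
  sup [set norm2 (p.1 - p.2) | p in A `*` A].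

Definition supergradients k (X : set 'rV[R]_k) (f : 'rV[R]_k -> R)
    (x : 'rV[R]_k) : set 'rV[R]_k :=
  [set zeta | forall y, X y -> f y <= f x + dot zeta (y - x)].

Definition normal_cone k (A : set 'rV[R]_k) (x : 'rV[R]_k) : set 'rV[R]_k :=
  [set z | forall y, A y -> dot z (y - x) <= 0].

Definition concave_function k (X : set 'rV[R]_k) (f : 'rV[R]_k -> R) :=
  @convex_function R 'rV[R]_k X (fun x => - f x).

End euclidean.

Section wasserstein.
Local Open Scope ereal_scope.
Variables (R : realType) (m : nat).

(* R^m with its Borel sigma-algebra. *)
Definition borel_space := g_sigma_algebraType (@open 'rV[R]_m).

Definition to_rV (x : borel_space) : 'rV[R]_m := x.

Definition prob_on (Xi : set borel_space) : set (probability borel_space R) :=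
  [set Q | [/\ Q Xi = 1,
    \int[Q]_x (norm1 (to_rV x))%:E < +oo &
    \int[Q]_x ((norm1 (to_rV x)) ^+ 2)%:E < +oo]].

Definition coupling (Q P : {measure set borel_space -> \bar R}) :
    set (probability (borel_space * borel_space)%type R) :=
  [set Pi | forall A, measurable A ->
    Pi (A `*` setT) = Q A /\ Pi (setT `*` A) = P A].

Definition wasserstein (Q P : {measure set borel_space -> \bar R}) : \bar R :=
  ereal_inf [set \int[Pi]_z (norm1 (to_rV z.1 - to_rV z.2)%R)%:E
            | Pi in coupling Q P].

Definition wasserstein_ball (Xi : set borel_space) (e : R)
    (P : {measure set borel_space -> \bar R}) :
    set (probability borel_space R) :=
  [set Q | prob_on Xi Q /\ wasserstein Q P <= e%:E].

Definition empirical (N : nat) (y : nat -> borel_space) :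
    {measure set borel_space -> \bar R} :=
  mscale ((N%:R^-1)%R : R)%:nng%R (msum (fun k => \d_(y k)) N).

End wasserstein.

Section games.
Variables (R : realType) (n m : nat) (dim : 'I_n -> nat).

Definition profile := prod_topology (fun i : 'I_n => 'rV[R]_(dim i)).

Definition profile_dist (s s' : profile) : R :=
  Num.sqrt (\sum_(i < n) norm2 (s i - s' i) ^+ 2).

(* [replace s i x] is the profile (x, s_{-i}) for x : 'rV_(dim i). *)
Definition replace (s : profile) (i : 'I_n) (x : 'rV[R]_(dim i)) : profile :=
  dfwith s i x.
Arguments replace : clear implicits.

(* [dom i] is the set on which U_i is a concave function of the own action,
   e.g. the whole space or [strat i].  It is kept separate from [strat i]
   because supergradients are relative to it: supergradients relative to a
   compact [strat i] absorb its normal cone, hence are unbounded at boundary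
   points.  The samples are an arbitrary realization; those of index < [nsamp]
   are used. *)
Record dr_game := DRGame {
  strat : forall i, set 'rV[R]_(dim i);
  dom : forall i, set 'rV[R]_(dim i);
  Xi : set 'rV[R]_m;
  util : 'I_n -> profile -> 'rV[R]_m -> R;
  lip : 'I_n -> R;
  nsamp : nat;
  sample : nat -> 'rV[R]_m;
  obs : 'rV[R]_m -> 'rV[R]_m;
  radius : 'I_n -> R;
  strat_neq0 : forall i, @strat i !=set0;
  strat_convex : forall i, @convex_set R 'rV[R]_(dim i) (@strat i);
  strat_compact : forall i, compact (@strat i);
  strat_dom : forall i, @strat i `<=` @dom i;
  dom_convex : forall i, @convex_set R 'rV[R]_(dim i) (@dom i);
  Xi_compact : compact Xi;
  util_continuous : forall i,
    {within [set p : profile * 'rV[R]_m | (forall j, @dom j (p.1 j)) /\ Xi p.2],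
      continuous (fun p => util i p.1 p.2)};
  util_concave : forall i s xi, (forall j, @dom j (s j)) -> Xi xi ->
    concave_function (@dom i) (fun x => util i (replace s i x) xi);
  util_lipschitz : forall i s xi xi', (forall j, @strat j (s j)) ->
    Xi xi -> Xi xi' ->
    `|util i s xi - util i s xi'| <= lip i * norm1 (xi - xi');
  nsamp_gt0 : (0 < nsamp)%N;
  sample_Xi : forall l, (l < nsamp)%N -> Xi (sample l);
  obs_sample_Xi : forall l, (l < nsamp)%N -> Xi (obs (sample l));
  radius_ge0 : forall i, 0 <= radius i
}.
Arguments strat : clear implicits.
Arguments dom : clear implicits.

Variable G : dr_game.

Definition strategies : set profile := [set s | forall i, strat G i (s i)].

Definition ambiguity (i : 'I_n) : set (probability (borel_space R m) R) :=
  wasserstein_ball (Xi G) (radius G i)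
    (empirical (nsamp G) (fun l => obs G (sample G l))).

Definition util_dr (i : 'I_n) (s : profile) : R :=
  fine (ereal_inf [set (\int[Q]_(xi in Xi G) (util G i s xi)%:E)%E
                  | Q in ambiguity i]).

Definition nash : set profile :=
  [set s | strategies s /\ forall i x, strat G i x ->
    util_dr i (replace s i x) <= util_dr i s].

Definition dist_nash (s : profile) : R :=
  inf [set profile_dist s s' | s' in nash].

(* Supergradients at x of U_i^DR(., s_{-i}). *)
Definition own_supergradients (i : 'I_n) (s : profile) (x : 'rV[R]_(dim i)) :
    set 'rV[R]_(dim i) :=
  supergradients (dom G i) (fun y => util_dr i (replace s i y)) x.

Definition bounded_supergradients (B : 'I_n -> R) :=
  forall i s, strategies s ->
  forall zeta, own_supergradients s (s i) zeta -> norm2 zeta <= B i.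

Definition amicable_supergradients (d c : 'I_n -> R) :=
  forall i, 0 < d i /\
  forall s s', strategies s -> strategies s' -> profile_dist s s' <= d i ->
  exists zeta1 zeta2 zeta3 : 'rV[R]_(dim i),
    [/\ own_supergradients s (s i) zeta1,
        own_supergradients s' (s i) zeta2,
        own_supergradients s (s' i) zeta3 &
        dot (zeta2 - zeta1) (s' i - s i) - dot (zeta3 - zeta1) (s' i - s i)
          <= c i * norm2 (s' i - s i) ^+ 2].

Definition argmax_selection (pi : forall i, 'rV[R]_(dim i) -> 'rV[R]_(dim i)) :=
  forall i phi, strat G i (pi i phi) /\
    forall x : 'rV[R]_(dim i), strat G i x -> dot x phi <= dot (pi i phi) phi.

Definition steepest_feasible (i : 'I_n) (s : profile)
    (p : 'rV[R]_(dim i) * 'rV[R]_(dim i)) :=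
  own_supergradients s (s i) p.1 /\ normal_cone (strat G i) (s i) p.2.

(* Only the difference of the two components of an optimizer is unique in
   general; v is any selection of first components of optimizers. *)
Definition steepest_selection (v : forall i, profile -> 'rV[R]_(dim i)) :=
  forall i s, strategies s ->
  exists z, steepest_feasible s (v i s, z) /\
    forall q, @steepest_feasible i s q ->
      norm2 (- v i s + z) ^+ 2 <= norm2 (- q.1 + q.2) ^+ 2.

(* Since 0.-1 = 0, the term s(t-1) is s(0) at t = 0, i.e. s(-1) = s(0). *)
Definition trajectory (alpha mu lambda : 'I_n -> R)
    (pi : forall i, 'rV[R]_(dim i) -> 'rV[R]_(dim i))
    (v : forall i, profile -> 'rV[R]_(dim i)) (s : nat -> profile) :=
  strategies (s 0%N) /\
  forall t i,
    let phi := mu i *: v i (s t) - (lambda i)^-1 *: (s t i - s t.-1 i) in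
    s t.+1 i = s t i + alpha i *: (pi i phi - s t i).

End games.
Arguments replace {R n dim} s i x.
Arguments strat {R n m dim} d i _.
Arguments dom {R n m dim} d i _.

(* Comparison functions are total functions constrained on their actual
   domains only. *)
Section comparison_functions.
Variable R : realType.

Definition class_K (sigma : R -> R) :=
  [/\ {within `[0, +oo[%classic, continuous sigma},
      forall x y, 0 <= x -> x < y -> sigma x < sigma y &
      sigma 0 = 0].

Definition class_KL (beta : R -> R -> R) :=
  [/\ {within `[0, +oo[%classic `*` `[0, +oo[%classic,
        continuous (fun p : R * R => beta p.1 p.2)},
      forall y, 0 <= y -> class_K (beta ^~ y),
      forall x y y', 0 <= x -> 0 <= y -> y <= y' -> beta x y' <= beta x y &
      forall x, 0 <= x -> beta x y @[y --> +oo] --> 0].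

Definition step_gain (rho : R -> R -> R) :=
  let D := `[0, 2^-1]%classic `*` `[0, +oo[%classic in
  [/\ forall p, D p -> 0 <= rho p.1 p.2,
      {within D, continuous (fun p : R * R => rho p.1 p.2)},
      forall x x' y, D (x, y) -> D (x', y) -> x < x' -> rho x y < rho x' y,
      forall x y y', D (x, y) -> D (x, y') -> y < y' -> rho x y < rho x y' &
      rho p.1 p.2 @[p --> within D (nbhs ((0, 0) : R * R))] --> 0].

End comparison_functions.

(* Main.v *)
Require Import Defs.
From mathcomp Require Import all_boot all_order all_algebra.
From mathcomp Require Import all_classical all_reals all_analysis.
From mathcomp Require Import ring lra.

(** In the amicability condition the supergradient [zeta1] cancels: what is left
    is that [zeta2], taken at the own action [x] against the opponents' actions
    of [s'], and [zeta3], taken at the own action [y] against those of [s],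
    satisfy [(zeta2 - zeta3) . (y - x) <= c |y - x|^2]. Two facts follow.

    First, the players decouple. Integrating the supergradient inequalities, the
    effect of the opponents' moving from [s] to [s'] on the gain of player [i]
    from switching [x] to [y] is at most [c |y - x|^2]. This effect is additive
    along the segment from [x] to [y], whereas the bound is quadratic in its
    length, so subdividing the segment drives the effect to zero
    ([decoupling]). Up to a term that player [i] cannot influence,
    [U_i^DR(s)] is thus a concave function of [s_i] alone, [own_payoff], and an
    equilibrium is a profile of separate maximizers ([nashP]).

    Second, with equal opponents the condition says that [own_payoff] has
    supergradients that are [c]-Lipschitz along segments: it is [c]-smooth
    ([own_payoff_smooth]). Each player therefore runs, on a fixed smooth concave
    function, the Frank-Wolfe method with step [alpha] and a momentum term. The
    momentum lowers the linear gain of a move by at most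
    [alpha D^2 / (lambda mu)], where the condition on [lambda] bounds
    [1 / (lambda mu)] by a function of [varrho] and [c], and smoothness costs
    another [c alpha^2 D^2] per step. So the optimality gap contracts by
    [1 - alpha] up to an error of order [alpha^2].

    The difficulty is that [v_i] is a supergradient relative to a domain that
    may be larger than the strategy set. On the boundary of the strategy set it
    may disagree with the one-sided derivative along the move. They do agree if
    the move is reversible, i.e. its direction can be followed both ways inside
    the strategy set. An irreversible move still costs only [O(alpha B D)], and
    the linear space of reversible directions grows strictly after each of them,
    so their number is at most the dimension ([few_irreversible_moves]). The gap
    after [t] steps is then at most [(1 - alpha)^t] times the initial gap plus
    [O(alpha)] ([frank_wolfe_rate]).

    Finally gaps are translated into distances. The payoffs are Lipschitz, so
    the initial gap is at most a multiple of the initial distance; by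
    compactness the distance is at most a class K function [sigma] of the total
    gap ([dist_nash_gain]). The splitting
    [sigma (p + r) <= max (sigma (2 p)) (sigma (2 r))]
    gives the two terms of the estimate, with [rho1 (x, y) = x + y]. *)

Set Implicit Arguments.
Unset Strict Implicit.
Unset Printing Implicit Defensive.

Import Order.TTheory GRing.Theory Num.Theory.
Import numFieldNormedType.Exports.

Local Open Scope classical_set_scope.
Local Open Scope ring_scope.

(** * Real inequalities *)

Section real_inequalities.
Variable R : realType.

Lemma exists_le_pow2 (x : R) : exists k : nat, x <= 2 ^+ k.
Proof.
exists (Num.bound `|x|); apply: le_trans (ler_norm x) _.
apply: le_trans (ltW (archi_boundP (normr_ge0 x))) _.
by rewrite -natrX ler_nat ltnW// ltn_expl.
Qed.

Lemma le0_of_le_pow2 (a b : R) : (forall k, a <= b / 2 ^+ k) -> a <= 0.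
Proof.
move=> H; rewrite leNgt; apply/negP => a0.
have [k bk] := exists_le_pow2 (b / a + 1).
have := H k; rewrite ler_pdivlMr ?exprn_gt0//.
have := ler_wpM2l (ltW a0) bk; rewrite mulrDr mulrCA mulfV ?gt_eqF// mulr1.
lra.
Qed.

Lemma sqrt_sum_sqr_le (I : finType) (f : I -> R) : (forall i, 0 <= f i) ->
  Num.sqrt (\sum_i f i ^+ 2) <= \sum_i f i.
Proof.
move=> f0; have s0 : 0 <= \sum_i f i by exact: sumr_ge0.
rewrite -[leRHS](ger0_norm s0) -sqrtr_sqr ler_wsqrtr// expr2 big_distrl /=.
apply: ler_sum => i _; rewrite expr2 ler_wpM2l// (bigD1 i)//= lerDl.
exact: sumr_ge0.
Qed.

End real_inequalities.

Lemma le0_of_le_small (R : realType) (a b r : R) : 0 < r ->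
  (forall e, 0 < e -> e <= r -> a <= b * e) -> a <= 0.
Proof.
move=> r0 H; rewrite leNgt; apply/negP => a0.
set e := Num.min r (a / (2 * (`|b| + 1))).
have b1 : 0 < `|b| + 1 by rewrite ltr_wpDl.
have e0 : 0 < e by rewrite lt_min r0 divr_gt0// mulr_gt0.
have ea : e * (2 * (`|b| + 1)) <= a.
  by rewrite -ler_pdivlMr ?mulr_gt0// ge_min lexx orbT.
have := H _ e0 (ltac:(by rewrite ge_min lexx)).
have : b * e <= `|b| * e by rewrite ler_pM2r// ler_norm.
lra.
Qed.

(** * Euclidean geometry of row vectors *)

Section euclidean_facts.
Variables (R : realType) (k : nat).
Implicit Types (x y z u : 'rV[R]_k) (a : R) (A : set 'rV[R]_k).

Lemma dotC x y : dot x y = dot y x.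
Proof. by apply: eq_bigr => j _; rewrite mulrC. Qed.

Lemma dotDl x y z : dot (x + y) z = dot x z + dot y z.
Proof. by rewrite -big_split; apply: eq_bigr => j _; rewrite mxE mulrDl. Qed.

Lemma dotZl a x y : dot (a *: x) y = a * dot x y.
Proof. by rewrite mulr_sumr; apply: eq_bigr => j _; rewrite mxE mulrA. Qed.

Lemma dotNl x y : dot (- x) y = - dot x y.
Proof. by rewrite -scaleN1r dotZl mulN1r. Qed.

Lemma dotDr x y z : dot x (y + z) = dot x y + dot x z.
Proof. by rewrite !(dotC x) dotDl. Qed.

Lemma dotZr a x y : dot x (a *: y) = a * dot x y.
Proof. by rewrite !(dotC x) dotZl. Qed.

Lemma dotNr x y : dot x (- y) = - dot x y.
Proof. by rewrite !(dotC x) dotNl. Qed.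

Lemma dot_ge0 x : 0 <= dot x x.
Proof. by apply: sumr_ge0 => j _; rewrite -expr2 sqr_ge0. Qed.

Lemma norm2_ge0 x : 0 <= norm2 x.
Proof. exact: sqrtr_ge0. Qed.

Lemma sqr_norm2 x : norm2 x ^+ 2 = dot x x.
Proof. by rewrite sqr_sqrtr ?dot_ge0. Qed.

Lemma norm2Z a x : norm2 (a *: x) = `|a| * norm2 x.
Proof.
by rewrite /norm2 dotZl dotZr mulrA -expr2 sqrtrM ?sqr_ge0// sqrtr_sqr.
Qed.

Lemma norm2N x : norm2 (- x) = norm2 x.
Proof. by rewrite -scaleN1r norm2Z normrN1 mul1r. Qed.

Lemma norm2B x y : norm2 (x - y) = norm2 (y - x).
Proof. by rewrite -norm2N opprB. Qed.

Lemma norm2_0 : norm2 (0 : 'rV[R]_k) = 0.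
Proof. by rewrite -(scale0r 0) norm2Z normr0 mul0r. Qed.

Lemma norm2_eq0 x : norm2 x = 0 -> x = 0.
Proof.
move=> /(congr1 (fun t => t ^+ 2)); rewrite sqr_norm2 expr0n /= => x0.
apply/rowP => j; rewrite mxE; apply/eqP; rewrite -sqrf_eq0 expr2.
have := @psumr_eq0P R 'I_k predT (fun j => x 0 j * x 0 j).
by move=> ->// i _; rewrite -expr2 sqr_ge0.
Qed.

Lemma cauchy_schwarz x y : dot x y <= norm2 x * norm2 y.
Proof.
have [x0|/eqP x0] := eqVneq (norm2 x) 0.
  by rewrite x0 (norm2_eq0 x0) -(scale0r 0) dotZl !mul0r.
have [y0|/eqP y0] := eqVneq (norm2 y) 0.
  by rewrite y0 (norm2_eq0 y0) -(scale0r 0) dotZr mul0r mulr0.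
have xy : 0 < norm2 x * norm2 y.
  by rewrite mulr_gt0// lt_neqAle norm2_ge0 andbT eq_sym; apply/eqP.
have := dot_ge0 (norm2 y *: x - norm2 x *: y).
rewrite !(dotDl, dotDr, dotNl, dotNr, dotZl, dotZr) -!sqr_norm2 (dotC y x).
set a := norm2 x in xy *; set b := norm2 y in xy *; set p := dot x y => h.
rewrite -(ler_pM2l xy).
lra.
Qed.

Lemma dot_geN x y : - (norm2 x * norm2 y) <= dot x y.
Proof. by rewrite lerNl -dotNl -(norm2N x) cauchy_schwarz. Qed.

Lemma sum_continuous (T : topologicalType) (I : Type) (r : seq I)
    (f : I -> T -> R) :
  (forall i, continuous (f i)) -> continuous (fun p => \sum_(i <- r) f i p).
Proof.
move=> cf; elim: r => [|i r IH] p.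
  rewrite (_ : (fun _ => _) = cst 0); first exact: cst_continuous.
  by apply/funext => z; rewrite big_nil.
rewrite (_ : (fun _ => _) = (fun q => f i q + \sum_(l <- r) f l q)).
  by apply: cvgD; [exact: cf|exact: IH].
by apply/funext => z; rewrite big_cons.
Qed.

Lemma norm2B_continuous z : continuous (fun x => norm2 (x - z)).
Proof.
move=> x; apply: (continuous_comp (f := fun x => dot (x - z) (x - z))).
  apply: (@sum_continuous _ _ _ (fun j x => (x - z) 0 j * (x - z) 0 j)) => j y.
  have cj : {for y, continuous (fun x => (x - z) 0 j)}.
    rewrite (_ : (fun _ => _) = fun x => x 0 j - z 0 j); last first.
      by apply/funext => q; rewrite !mxE.
    exact: (cvgB (@coord_continuous R _ _ 0 j y) (cvg_cst (z 0 j))).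
  exact: (cvgM cj cj).
exact: sqrt_continuous.
Qed.

Lemma compact_norm2_bounded A : compact A ->
  exists M, forall x, A x -> norm2 x <= M.
Proof.
move=> cA; have [->|/set0P A0] := eqVneq A set0; first by exists 0.
have [|x _ xM] := EVT_max_rV A0 cA (f := fun x => norm2 (x - 0)).
  by apply: continuous_subspaceT; exact: norm2B_continuous.
by exists (norm2 (x - 0)) => y /mem_set /xM; rewrite !subr0.
Qed.

End euclidean_facts.

(** * Concave functions with slowly varying supergradients *)

Section smooth_concave.
Variables (R : realType) (k : nat) (S : set 'rV[R]_k) (F : 'rV[R]_k -> R).

Definition segment_closed := forall x y (l : R), S x -> S y ->
  0 <= l -> l <= 1 -> S (x + l *: (y - x)).

(** For a concave [F] the pairing below is nonnegative, so the bound says that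
    some selection of supergradients is Lipschitz along segments: [F] is a
    concave function with curvature at most [c]. *)
Definition smooth_concave (B c d : R) := forall x y, S x -> S y ->
  norm2 (y - x) <= d -> exists zx zy,
  [/\ supergradients S F x zx, supergradients S F y zy, norm2 zy <= B &
      dot (zx - zy) (y - x) <= c * norm2 (y - x) ^+ 2].

Definition reversible (x u : 'rV[R]_k) :=
  exists2 e : R, 0 < e & S (x + e *: u) /\ S (x - e *: u).

Variables (B c d : R).
Hypotheses (SS : segment_closed) (sF : smooth_concave B c d) (d0 : 0 < d).

Lemma bounded_supergradient x : S x ->
  exists2 z, supergradients S F x z & norm2 z <= B.
Proof.
move=> Sx; have [|_ [z [_ h1 h2 _]]] := sF Sx Sx.
  by rewrite subrr norm2_0 ltW.
by exists z.
Qed.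

Lemma lipschitz_concave x y : S x -> S y -> F x - F y <= B * norm2 (x - y).
Proof.
move=> Sx Sy; have [z zy zB] := bounded_supergradient Sy.
rewrite lerBlDl (le_trans (zy _ Sx))// lerD2l.
by rewrite (le_trans (cauchy_schwarz _ _))// ler_wpM2r// norm2_ge0.
Qed.

Lemma smooth_lower_bound x y : S x -> S y -> norm2 (y - x) <= d ->
  exists2 z, supergradients S F x z &
    F x + dot z (y - x) - c * norm2 (y - x) ^+ 2 <= F y.
Proof.
move=> Sx Sy /(sF Sx Sy)[zx [zy [hx hy _]]].
rewrite dotDl dotNl => h; exists zx => //.
have := hy _ Sx; rewrite -(opprB y x) dotNr.
lra.
Qed.

Lemma segment_shrink x u (e e' : R) : S x -> S (x + e *: u) ->
  0 < e -> 0 <= e' <= e -> S (x + e' *: u).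
Proof.
move=> Sx Su e0 /andP[e'0 e'e].
have -> : x + e' *: u = x + (e' / e) *: (x + e *: u - x).
  by rewrite [x + e *: u]addrC addrK scalerA divfK// gt_eqF.
apply: SS => //; first by rewrite divr_ge0// ltW.
by rewrite ler_pdivrMr// mul1r.
Qed.

(** Supergradients at nearby points ahead and behind squeeze all those at [x]
    in the direction [u], and smoothness brings these two together. *)
Lemma reversible_supergradients x u z z' : S x -> reversible x u ->
  supergradients S F x z -> supergradients S F x z' -> dot z u <= dot z' u.
Proof.
move=> Sx [e e0 [Sp Sm]] hz hz'; rewrite -subr_le0.
have [u0|u0] := eqVneq (norm2 u) 0.
  by rewrite (norm2_eq0 u0) !(dotC _ 0) -(scale0r 0) !dotZl !mul0r subrr.
have {}u0 : 0 < norm2 u by rewrite lt_neqAle eq_sym u0 norm2_ge0.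
apply: (@le0_of_le_small _ _ (2 * c * norm2 u ^+ 2)
    (Num.min e (d / (2 * norm2 u)))).
  by rewrite lt_min e0 divr_gt0// mulr_gt0.
move=> r r0; rewrite le_min => /andP[re rd].
have {}rd : r * (2 * norm2 u) <= d by rewrite -ler_pdivlMr// mulr_gt0.
have {}Sp : S (x + r *: u) by apply: (segment_shrink Sx Sp) => //; rewrite ltW.
have {}Sm : S (x - r *: u).
  by rewrite -scalerN; apply: (@segment_shrink _ _ e) => //;
     rewrite ?scalerN// ltW.
have E : x + r *: u - (x - r *: u) = (2 * r) *: u.
  by apply/rowP => j; rewrite !mxE; ring.
have nE : norm2 ((2 * r) *: u) = 2 * r * norm2 u.
  by rewrite norm2Z ger0_norm// mulr_ge0// ltW.
have [|p [q [hp hq _]]] := sF Sm Sp.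
  by rewrite E nE; lra.
rewrite E nE dotZr dotDl dotNl => hpq.
have := hz _ Sm; have := hp _ Sx; have := hz' _ Sp; have := hq _ Sx.
have -> : x - r *: u - x = - (r *: u) by rewrite addrAC subrr add0r.
have -> : x - (x - r *: u) = r *: u by rewrite opprB addrC subrK.
have -> : x + r *: u - x = r *: u by rewrite addrAC subrr add0r.
have -> : x - (x + r *: u) = - (r *: u) by rewrite opprD addrA subrr add0r.
rewrite !(dotNr, dotZr) => h1 h2 h3 h4.
have zp : r * dot z u <= r * dot p u by lra.
have qz : r * dot q u <= r * dot z' u by lra.
rewrite -(ler_pM2l r0).
have : r * (dot p u - dot q u) <= r * (2 * c * norm2 u ^+ 2 * r).
  by rewrite -(ler_pM2l (ltr0n R 2)); lra.
lra.
Qed.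

(** Smoothness bounds the increase below through some supergradient at [x]; a
    reversible direction makes any other one as good. *)
Lemma reversible_ascent x u v (a : R) : S x -> S (x + a *: u) ->
  reversible x u -> supergradients S F x v -> 0 <= a -> a * norm2 u <= d ->
  F x + a * dot v u - c * (a * norm2 u) ^+ 2 <= F (x + a *: u).
Proof.
move=> Sx Sy xu xv a0 ad.
have nE : norm2 (x + a *: u - x) = a * norm2 u.
  by rewrite addrAC subrr add0r norm2Z ger0_norm.
have [|z xz] := smooth_lower_bound Sx Sy; first by rewrite nE.
rewrite nE; apply: le_trans.
rewrite lerD2r lerD2l addrAC subrr add0r dotZr ler_wpM2l//.
exact: (reversible_supergradients Sx xu).
Qed.

End smooth_concave.

(** * Averaging moves inside a convex set *)

Section averaging.
Variables (R : realType) (k : nat) (S : set 'rV[R]_k).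
Hypothesis SS : segment_closed S.

Lemma reversible0 x : S x -> reversible S x 0.
Proof. by move=> Sx; exists 1 => //; rewrite scaler0 subr0 addr0. Qed.

Lemma reversibleN x u : reversible S x u -> reversible S x (- u).
Proof. by move=> [e e0 [h1 h2]]; exists e => //; rewrite scalerN opprK. Qed.

Lemma reversibleZ x u (a : R) : S x -> reversible S x u ->
  reversible S x (a *: u).
Proof.
move=> Sx xu; wlog a0 : a / 0 < a => [H|].
  have [/H//|a0|<-] := ltgtP 0 a; last by rewrite scale0r; exact: reversible0.
  by rewrite -(opprK a) scaleNr; apply: reversibleN; apply: H; rewrite oppr_gt0.
have [e e0 h] := xu; exists (e / a); first by rewrite divr_gt0.
by rewrite scalerA divfK// gt_eqF.
Qed.

Lemma reversibleD x u v : S x -> reversible S x u -> reversible S x v ->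
  reversible S x (u + v).
Proof.
move=> Sx [e e0 [up um]] [f f0 [vp vm]].
set r := Num.min e f; have r0 : 0 < r by rewrite lt_min e0.
have re : 0 <= r <= e by rewrite (ltW r0) ge_min lexx.
have rf : 0 <= r <= f by rewrite (ltW r0) ge_min lexx orbT.
have mid (p q : 'rV[R]_k) : S (x + r *: p) -> S (x + r *: q) ->
    S (x + (r / 2) *: (p + q)).
  move=> Sp Sq.
  have -> : x + (r / 2) *: (p + q) =
      x + r *: p + 2^-1 *: (x + r *: q - (x + r *: p)).
    by apply/rowP => j; rewrite !mxE; lra.
  by apply: SS => //; lra.
exists (r / 2); first by rewrite divr_gt0.
split; first by apply: mid; [exact: segment_shrink up _ re|
  exact: segment_shrink vp _ rf].
rewrite -scalerN opprD; apply: mid.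
  by apply: segment_shrink re => //; rewrite scalerN.
by apply: segment_shrink rf => //; rewrite scalerN.
Qed.

Variables (a : R) (p s : nat -> 'rV[R]_k).
Hypotheses (a0 : 0 < a) (a1 : a < 1) (s0 : S (s 0%N)) (Sp : forall t, S (p t)).
Hypothesis s_step : forall t, s t.+1 = s t + a *: (p t - s t).

Lemma averaging_in t : S (s t).
Proof.
elim: t => [//|t IH]; rewrite s_step.
by apply: SS => //; rewrite ltW.
Qed.

Lemma reversible_step t u : reversible S (s t) u -> reversible S (s t.+1) u.
Proof.
move=> [e e0 [up um]]; exists ((1 - a) * e); 
  first by rewrite mulr_gt0 ?subr_gt0.
rewrite s_step; split.
  have -> : s t + a *: (p t - s t) + ((1 - a) * e) *: u =
      s t + e *: u + a *: (p t - (s t + e *: u)).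
    by apply/rowP => j; rewrite !mxE; ring.
  by apply: SS => //; exact: ltW.
have -> : s t + a *: (p t - s t) - ((1 - a) * e) *: u =
    s t - e *: u + a *: (p t - (s t - e *: u)).
  by apply/rowP => j; rewrite !mxE; ring.
by apply: SS => //; exact: ltW.
Qed.

Lemma reversible_last_move t : reversible S (s t.+1) (p t - s t).
Proof.
exists (Num.min a (1 - a)); first by rewrite lt_min a0 subr_gt0.
have m0 : 0 < Num.min a (1 - a) by rewrite lt_min a0 subr_gt0.
have ma : Num.min a (1 - a) <= a by rewrite ge_min lexx.
have m1 : Num.min a (1 - a) <= 1 - a by rewrite ge_min lexx orbT.
rewrite s_step; set m := Num.min _ _ in m0 ma m1 *.
rewrite -!addrA -scalerDl -scalerBl; have St := averaging_in t.
by split; apply: SS => //; lra.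
Qed.

(** The reversible directions at [s t] form a subspace which never shrinks, and
    which gains the direction of any move that was not reversible: this can
    happen at most [k] times. *)
Lemma few_irreversible_moves t :
  (\sum_(i < t) ~~ `[< reversible S (s i) (p i - s i) >] <= k)%N.
Proof.
(* [A] spans reversible directions, one for each irreversible move so far. *)
suff [A] : exists A : 'M[R]_k,
    (forall w : 'rV_k, (w <= A)%MS -> reversible S (s t) w) /\
    (\sum_(i < t) ~~ `[< reversible S (s i) (p i - s i) >] <= \rank A)%N.
  by move=> [_ /leq_trans]; apply; exact: rank_leq_row.
elim: t => [|t [A [rA nA]]].
  exists 0; split; last by rewrite big_ord0.
  by move=> w /submx0null ->; exact: reversible0.
rewrite big_ord_recr /=; have [mt|mt] := asboolP (reversible S (s t) _).
  by exists A; rewrite addn0; split => // w /rA /reversible_step.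
exists (A + (p t - s t))%MS; split => [w /sub_addsmxP[[w1 w2] /= ->]|].
  have St := averaging_in t.+1.
  apply: reversibleD => //.
    by apply/reversible_step/rA; rewrite submxMl.
  rewrite (mx11_scalar w2) mul_scalar_mx; apply: reversibleZ => //.
  exact: reversible_last_move.
rewrite addn1 (leq_ltn_trans nA)// rank_ltmx// ltmxE addsmxSl /=.
by rewrite addsmx_sub negb_and; apply/orP; right; apply/negP => /rA.
Qed.

End averaging.

(** * Frank-Wolfe steps with a momentum term *)

Section frank_wolfe.
Variables (R : realType) (k : nat) (S : set 'rV[R]_k) (F : 'rV[R]_k -> R).
Variables (B c d D a kappa : R) (p s v : nat -> 'rV[R]_k) (xs : 'rV[R]_k).
Hypotheses (SS : segment_closed S) (sF : smooth_concave S F B c d) (d0 : 0 < d).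
Hypotheses (B0 : 0 <= B) (c0 : 0 <= c) (k0 : 0 <= kappa).
Hypotheses (a0 : 0 < a) (a1 : a < 1) (aD : a * D <= d).
Hypothesis diamS : forall x y, S x -> S y -> norm2 (x - y) <= D.
Hypotheses (s0 : S (s 0%N)) (Sp : forall t, S (p t)) (Sxs : S xs).
Hypothesis s_step : forall t, s t.+1 = s t + a *: (p t - s t).
Hypothesis vF : forall t, supergradients S F (s t) (v t).
Hypothesis near_best : forall t,
  dot (v t) (xs - s t) <= dot (v t) (p t - s t) + kappa * a * D ^+ 2.

Let Ss t : S (s t) := averaging_in SS a0 a1 s0 Sp s_step t.

Let D0 : 0 <= D.
Proof. by apply: le_trans (diamS Sxs Sxs); exact: norm2_ge0. Qed.

(** A reversible move gains the fraction [a] of the optimality gap up to second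
    order in [a]. An irreversible one falls short of that by at most
    [2 * a * B * D], half for the Lipschitz loss and half for the missing
    contraction, and there are at most [k] of those. *)
Lemma frank_wolfe_rate t :
  F xs - F (s t) <= (1 - a) ^+ t * (F xs - F (s 0%N)) +
                    a * ((kappa + c) * D ^+ 2 + 2 * k%:R * B * D).
Proof.
pose bad i : nat := ~~ `[< reversible S (s i) (p i - s i) >].
suff H : F xs - F (s t) <= (1 - a) ^+ t * (F xs - F (s 0%N)) +
    a * ((kappa + c) * D ^+ 2 + 2 * (\sum_(i < t) bad i)%:R * B * D).
  apply: (le_trans H); rewrite lerD2l ler_wpM2l ?(ltW a0)// lerD2l.
  do 2 (apply: ler_wpM2r => //); rewrite ler_wpM2l// ler_nat.
  exact: (few_irreversible_moves SS a0 a1 s0 Sp s_step).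
elim: t => [|t IH].
  rewrite big_ord0 expr0 mul1r lerDl mulr_ge0 ?(ltW a0)// mulr0 !mul0r addr0.
  by rewrite mulr_ge0 ?sqr_ge0 ?addr_ge0.
have Du : norm2 (p t - s t) <= D by exact: diamS.
have u0 := norm2_ge0 (p t - s t).
rewrite big_ord_recr /= exprS natrD.
set n := (\sum_(i < t) _)%:R in IH *; have n0 : 0 <= n :> R by exact: ler0n.
set X := (1 - a) ^+ t * _ in IH; set Y := (kappa + c) * D ^+ 2 in IH *.
have key : F xs - F (s t.+1) <=
    (1 - a) * (F xs - F (s t)) + a * (a * Y + 2 * (bad t)%:R * B * D).
  rewrite /bad s_step; have [rev|_] := asboolP (reversible S (s t) _).
    have Sy : S (s t + a *: (p t - s t)) by rewrite -s_step.
    have au : a * norm2 (p t - s t) <= d.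
      by apply: le_trans aD; rewrite ler_pM2l.
    have := reversible_ascent SS sF d0 (Ss t) Sy rev (vF t) (ltW a0) au.
    have := near_best t; have := vF t Sxs.
    have : (a * norm2 (p t - s t)) ^+ 2 <= (a * D) ^+ 2.
      by rewrite ler_sqr ?nnegrE ?mulr_ge0 ?(ltW a0)// ler_pM2l.
    move=> /(ler_wpM2l c0); rewrite exprMn [in X in _ <= X -> _]exprMn.
    move=> h1 h2 h3 h4.
    have := lerD h2 h3; rewrite -(ler_pM2l a0) => h5.
    rewrite /Y /=; lra.
  have := lipschitz_concave sF d0 (Ss t) (Ss t.+1).
  have := lipschitz_concave sF d0 Sxs (Ss t).
  have -> : s t - s t.+1 = - a *: (p t - s t).
    by apply/rowP => j; rewrite s_step !mxE; ring.
  rewrite -s_step norm2Z normrN (gtr0_norm a0) => h1 h2.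
  have h3 : B * norm2 (xs - s t) <= B * D by rewrite ler_wpM2l ?diamS.
  have h4 : a * (B * norm2 (p t - s t)) <= a * (B * D).
    by rewrite ler_pM2l// ler_wpM2l.
  have h5 : a * (F xs - F (s t)) <= a * (B * D).
    by rewrite ler_pM2l//; exact: le_trans h1 h3.
  have Y0 : 0 <= a * (a * Y).
    by rewrite !mulr_ge0 ?(ltW a0) ?sqr_ge0 ?addr_ge0.
  rewrite /= mulr1; lra.
apply: (le_trans key).
have a1' : 0 <= 1 - a by rewrite subr_ge0 ltW.
have := ler_wpM2l a1' IH; rewrite -/X.
have : 0 <= a * a * (n * (B * D)) by rewrite !mulr_ge0 ?(ltW a0).
set b : R := (bad t)%:R.
rewrite /X; set Z := (1 - a) ^+ t * _.
rewrite -(mulrA (1 - a) ((1 - a) ^+ t)) -/Z.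
nra.
Qed.

End frank_wolfe.

(** Scaling the payoff direction by [mu] is harmless since a linear maximizer is
    scale-invariant; only [lambda * mu] matters. *)
Lemma momentum_near_best (R : realType) (k : nat) (S : set 'rV[R]_k)
    (v delta p x xs : 'rV[R]_k) (a D mu lambda : R) :
  0 < mu -> 0 < lambda -> S xs ->
  (forall y, S y -> dot y (mu *: v - lambda^-1 *: delta) <=
                    dot p (mu *: v - lambda^-1 *: delta)) ->
  norm2 delta <= a * D -> norm2 (xs - p) <= D ->
  dot v (xs - x) <= dot v (p - x) + (lambda * mu)^-1 * a * D ^+ 2.
Proof.
move=> mu0 la0 Sxs /(_ _ Sxs); rewrite !dotDr !dotNr !dotZr => h hd hp.
have h1 : dot (xs - p) delta <= a * D ^+ 2.
  rewrite (le_trans (cauchy_schwarz _ _))// mulrC expr2 mulrA.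
  by apply: ler_pM => //; exact: norm2_ge0.
have {h} h2 :
    mu * (dot v xs - dot v p) <= lambda^-1 * (dot xs delta - dot p delta).
  by rewrite !(dotC v) !mulrBr; lra.
have h3 : lambda^-1 * (dot xs delta - dot p delta) <= lambda^-1 * (a * D ^+ 2).
  by rewrite ler_pM2l ?invr_gt0// -dotNl -dotDl.
have h4 : dot v xs - dot v p <= (lambda * mu)^-1 * (a * D ^+ 2).
  rewrite invfM -mulrA mulrCA -(ler_pM2l mu0) (mulrA mu) mulfV ?gt_eqF// mul1r.
  exact: le_trans h2 h3.
by rewrite mulrA in h4; lra.
Qed.

(** * Approximate maximizers are close to maximizers *)

Section maximizers.
Variables (R : realType) (k : nat) (S : set 'rV[R]_k) (F : 'rV[R]_k -> R).
Variable (B : R).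
Hypotheses (S0 : S !=set0) (cS : compact S).
Hypothesis lipF : forall x y, S x -> S y -> F x - F y <= B * norm2 (x - y).

Lemma lipschitz_continuous_within : {within S, continuous F}.
Proof.
apply/subspace_continuousP => x Sx.
have cn : norm2 (y - x) @[y --> x] --> (0 : R).
  by rewrite -(norm2_0 R k) -(subrr x); exact: norm2B_continuous.
have cB (b : R) : F x + b * norm2 (y - x) @[y --> within S (nbhs x)] --> F x.
  apply: cvg_within_filter.
  have := cvgD (cvg_cst (F x)) (cvgM (cvg_cst b) cn).
  by rewrite mulr0 addr0; apply.
apply: squeeze_cvgr (cB (- B)) (cB B).
near=> y; have Sy : S y by near: y; exact: withinT.
have := lipF Sx Sy; have := lipF Sy Sx; rewrite (norm2B x y) => h1 h2.
by apply/andP; rewrite /from_subspace /=; split; lra.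
Unshelve. all: by end_near. Qed.

Lemma maximizer_exists : exists2 xs, S xs & forall x, S x -> F x <= F xs.
Proof.
have [xs /set_mem Sxs H] := EVT_max_rV S0 cS lipschitz_continuous_within.
by exists xs => // x /mem_set /H.
Qed.

(** The points at distance at least [e] from every maximizer form a compact set,
    on which [F] attains a maximum below the global one. *)
Lemma near_maximizer xs (e : R) : S xs -> (forall x, S x -> F x <= F xs) ->
  0 < e -> exists2 r : R, 0 < r & forall x, S x -> F xs - F x <= r ->
  exists y, [/\ S y, F y = F xs & norm2 (x - y) <= e].
Proof.
move=> Sxs H e0.
pose far := S `&` \bigcap_(y in [set y | S y /\ F y = F xs])
  [set x | e <= norm2 (x - y)].
have cfar : compact far.
  apply: compact_closedI => //; apply: closed_bigI => y _.
  have nc : {in ~` (fun x => norm2 (x - y)) @^-1` [set r | e <= r],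
      continuous (fun x : 'rV[R]_k => norm2 (x - y))}.
    by move=> x _; exact: norm2B_continuous.
  apply: (preimage_closed nc); exact: closed_ge.
have nearP x : S x -> ~ far x ->
    exists y, [/\ S y, F y = F xs & norm2 (x - y) <= e].
  move=> Sx nfar; apply: contrapT => no; apply: nfar; split=> // y [Sy yxs] /=.
  by rewrite leNgt; apply/negP => /ltW xy; apply: no; exists y.
have [far0|/set0P far0] := eqVneq far set0.
  by exists 1 => // x Sx _; apply: nearP => //; rewrite far0.
have [|z /set_mem [Sz zfar] zmax] := EVT_max_rV far0 cfar (f := F).
  by apply: continuous_subspaceW lipschitz_continuous_within => x [].
have zxs : F z < F xs.
  rewrite lt_neqAle H// andbT; apply/eqP => zxs.
  by have := zfar z (conj Sz zxs); rewrite /= subrr norm2_0 leNgt e0.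
exists ((F xs - F z) / 2); first by rewrite divr_gt0 ?subr_gt0.
move=> x Sx xr; apply: nearP => // /mem_set /zmax xz; lra.
Qed.

End maximizers.

(** * Comparison functions *)

(** The lower envelope of the affine majorants of [w] as a function of [h] is
    continuous because it is monotone and star-shaped, and vanishes at [0]
    because [w] is bounded and is small where [h] is. *)
Section class_K_majorant.
Variables (R : realType) (T : Type) (A : set T) (w h : T -> R) (M : R).
Hypotheses (h0 : forall x, A x -> 0 <= h x) (wM : forall x, A x -> w x <= M).
Hypothesis wh : forall e, 0 < e ->
  exists2 r, 0 < r & forall x, A x -> h x <= r -> w x <= e.

Let majorant (q : R * R) :=
  [/\ 0 < q.1, 0 <= q.2 & forall x, A x -> w x <= q.1 + q.2 * h x].

Let env (r : R) := inf [set q.1 + q.2 * `|r| | q in majorant].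

Let majorant_neq0 (r : R) : [set q.1 + q.2 * `|r| | q in majorant] !=set0.
Proof.
exists (Num.max M 1 + 0 * `|r|), (Num.max M 1, 0) => //; split => //=.
  by rewrite lt_max ltr01 orbT.
by move=> x Ax; rewrite mul0r addr0 le_max wM.
Qed.

Let env_le q r : majorant q -> env r <= q.1 + q.2 * `|r|.
Proof.
move=> mq; apply: ge_inf; last by exists q.
by exists 0 => _ [[a b] [/= a0 b0 _] <-]; rewrite addr_ge0 ?mulr_ge0// ltW.
Qed.

Let le_env r y : (forall q, majorant q -> y <= q.1 + q.2 * `|r|) -> y <= env r.
Proof.
move=> H; apply: (lb_le_inf (majorant_neq0 r)) => _ [q mq <-]; exact: H.
Qed.

Let env_ge0 r : 0 <= env r.
Proof.
apply: le_env => -[a b] [/= a0 b0 _].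
by rewrite addr_ge0 ?mulr_ge0// ltW.
Qed.

Let env_mono r r' : `|r| <= `|r'| -> env r <= env r'.
Proof.
move=> rr; apply: le_env => q mq; apply: le_trans (env_le r mq) _.
by rewrite lerD2l ler_wpM2l//; case: mq.
Qed.

Let env_star r r' : 0 < `|r| -> `|r| <= `|r'| ->
  env r' <= `|r'| / `|r| * env r.
Proof.
move=> r0 rr; rewrite -ler_pdivrMl; last by rewrite divr_gt0// (lt_le_trans r0).
apply: le_env => q mq; rewrite ler_pdivrMl; last first.
  by rewrite divr_gt0// (lt_le_trans r0).
apply: le_trans (env_le r' mq) _; case: mq => q1 q2 _.
rewrite mulrDr (mulrCA _ q.2) divfK ?gt_eqF// lerD2r ler_peMl ?(ltW q1)//.
by rewrite ler_pdivlMr// mul1r.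
Qed.

Let small_majorant e : 0 < e -> exists2 b, 0 <= b & majorant (e, b).
Proof.
move=> e0; have [r r0 H] := wh e0; exists (Num.max M 0 / r).
  by rewrite divr_ge0 ?(ltW r0)// le_max lexx orbT.
split => //=; first by rewrite divr_ge0 ?(ltW r0)// le_max lexx orbT.
move=> x Ax; have [xr|/ltW xr] := leP (h x) r.
  apply: le_trans (H _ Ax xr) _.
  by rewrite lerDl mulr_ge0 ?h0// divr_ge0 ?(ltW r0)// le_max lexx orbT.
apply: (@le_trans _ _ (Num.max M 0)); first by rewrite le_max wM.
rewrite -[X in X <= _]add0r lerD ?(ltW e0)//.
by rewrite -mulrA ler_peMr ?le_max ?lexx ?orbT// ler_pdivlMl// mulr1.
Qed.

Let env0 : env 0 = 0.
Proof.
apply/eqP; rewrite eq_le env_ge0 andbT; apply/ler_addgt0Pr => e e0.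
have [b _ mb] := small_majorant e0.
by apply: le_trans (env_le 0 mb) _; rewrite normr0 mulr0 addr0 add0r.
Qed.

Let env_continuous : continuous env.
Proof.
move=> r; have [->|r0] := eqVneq r 0.
  apply/cvgrPdist_le => e e0; rewrite env0.
  have e20 : 0 < e / 2 by rewrite divr_gt0.
  have [b b0 mb] := small_majorant e20.
  near=> y; rewrite sub0r normrN ger0_norm//.
  apply: le_trans (env_le y mb) _ => /=.
  suff : b * `|y| <= e / 2 by lra.
  have : `|y| <= e / 2 / (b + 1).
    near: y; exists (e / 2 / (b + 1)) => /=.
      by rewrite divr_gt0// ltr_wpDl.
    by move=> y /=; rewrite sub0r normrN => /ltW.
  rewrite ler_pdivlMr ?ltr_wpDl// => yb; have := normr_ge0 y; nra.
have nr0 : 0 < `|r| by rewrite normr_gt0.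
have cn : continuous (fun y : R => `|y|) by exact: norm_continuous.
have cr : {for r, continuous (fun y => `|y| / `|r|)}.
  by apply: cvgM; [exact: cn|exact: cvg_cst].
have lo : Num.min (`|y| / `|r|) 1 * env r @[y --> r] --> env r.
  rewrite -[X in _ --> X]mul1r; apply: cvgM; last exact: cvg_cst.
  have : Num.min (`|y| / `|r|) 1 @[y --> r] --> Num.min (`|r| / `|r|) 1.
    exact: continuous_min cr (@cst_continuous R R 1 r).
  by rewrite mulfV ?gt_eqF// minxx.
have hi : Num.max (`|y| / `|r|) 1 * env r @[y --> r] --> env r.
  rewrite -[X in _ --> X]mul1r; apply: cvgM; last exact: cvg_cst.
  have : Num.max (`|y| / `|r|) 1 @[y --> r] --> Num.max (`|r| / `|r|) 1.
    exact: continuous_max cr (@cst_continuous R R 1 r).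
  by rewrite mulfV ?gt_eqF// maxxx.
apply: squeeze_cvgr lo hi; near=> y.
have y0 : 0 < `|y|.
  near: y; exists `|r| => //= y /=; rewrite normr_gt0; apply: contraTneq => ->.
  by rewrite subr0 ltxx.
have [yr|/ltW ry] := leP `|y| `|r|.
  apply/andP; split.
    apply: (@le_trans _ _ (`|y| / `|r| * env r)).
      by rewrite ler_wpM2r// ge_min lexx.
    have := env_star y0 yr; rewrite -ler_pdivrMl ?divr_gt0// invfM invrK.
    by rewrite (mulrC _^-1).
  apply: (@le_trans _ _ (env r)); first exact: env_mono.
  by rewrite ler_peMl// le_max lexx orbT.
apply/andP; split.
  apply: (@le_trans _ _ (env r)); last exact: env_mono.
  by rewrite ler_piMl// ge_min lexx orbT.
apply: le_trans (env_star nr0 ry) _.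
by rewrite ler_wpM2r// le_max lexx.
Unshelve. all: by end_near. Qed.

Lemma class_K_majorant : exists sigma : R -> R,
  [/\ continuous sigma, class_K sigma & forall x, A x -> w x <= sigma (h x)].
Proof.
have c : continuous (fun r => env r + r).
  by move=> r; apply: cvgD; [exact: env_continuous|exact: cvg_id].
exists (fun r => env r + r); split => //.
  split; first exact: continuous_subspaceT.
    move=> x y x0 xy; rewrite ler_ltD// env_mono// !ger0_norm ?(ltW xy)//.
    exact: le_trans x0 (ltW xy).
  by rewrite env0 addr0.
move=> x Ax; apply: (@le_trans _ _ (env (h x))); last by rewrite lerDl h0.
by apply: le_env => q [_ _ H]; rewrite ger0_norm ?h0// H.
Qed.

End class_K_majorant.

Section rescaling.
Variables (R : realType) (sigma : R -> R).
Hypotheses (cs : continuous sigma) (Ks : class_K sigma).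

Lemma class_K_rescale (a : R) : 0 < a -> class_K (fun r => sigma (a * r)).
Proof.
move=> a0; case: Ks => _ inc s0; split; last by rewrite mulr0.
  apply: continuous_subspaceT => r.
  apply: (continuous_comp (f := fun r => a * r)).
    by apply: cvgM; [exact: cvg_cst|exact: cvg_id].
  exact: cs.
by move=> x y x0 xy; apply: inc; [rewrite mulr_ge0// ltW|rewrite ltr_pM2l].
Qed.

Lemma class_K_mono x y : 0 <= x -> x <= y -> sigma x <= sigma y.
Proof.
case: Ks => _ inc _ x0; rewrite le_eqVlt => /predU1P[->//|xy].
exact/ltW/inc.
Qed.

(** The real power [q `^ y] is continuous in [y] and extends the geometric
    decay of the integer iterates. *)
Lemma class_KL_geometric (a q : R) : 0 < a -> 0 < q -> q < 1 ->
  class_KL (fun x y => sigma (a * (x * q `^ y))).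
Proof.
move=> a0 q0 q1; have l0 : ln q < 0 by rewrite ln_lt0// q0.
have pE (y : R) : q `^ y = expR (y * ln q) by rewrite /powR gt_eqF.
have cp : continuous (fun y : R => q `^ y).
  rewrite (_ : powR q = expR \o (fun y => y * ln q)); last first.
    by apply/funext => y; exact: pE.
  move=> y; apply: continuous_comp; last exact: continuous_expR.
  by apply: cvgM; [exact: cvg_id|exact: cvg_cst].
have p0 y : 0 < q `^ y by exact: powR_gt0.
split.
- apply: continuous_subspaceT => -[x y].
  apply: (continuous_comp (f := fun p : R * R => a * (p.1 * q `^ p.2))).
    apply: cvgM; first exact: cvg_cst.
    apply: cvgM; first exact: cvg_fst.
    apply: (continuous_comp (f := fun p : R * R => p.2)); first exact: cvg_snd.
    exact: cp.
  exact: cs.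
- move=> y _; rewrite (_ : (fun _ => _) = fun x => sigma (a * q `^ y * x)).
    by apply: class_K_rescale; rewrite mulr_gt0.
  by apply/funext => x; rewrite -mulrA (mulrC x).
- move=> x y y' x0 y0 yy; apply: class_K_mono.
    by rewrite !mulr_ge0 ?(ltW a0)// ltW.
  rewrite ler_pM2l// ler_wpM2l// !pE ler_expR ler_wnM2r// ltW//.
- move=> x x0; case: Ks => _ _ s0.
  have : (a * (x * q `^ y)) @[y --> +oo] --> (0 : R).
    rewrite -(mulr0 a) -[X in a * X](mulr0 x).
    apply: cvgM; first exact: cvg_cst.
    apply: cvgM; first exact: cvg_cst.
    rewrite (_ : powR q =
        (fun y => expR (- y)) \o (fun y => y * - ln q)); last first.
      by apply/funext => y /=; rewrite pE mulrN opprK.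
    apply: cvg_comp (@cvgr_expR R).
    by apply: gt0_cvgMly; [rewrite oppr_gt0|exact: cvg_id].
  by move=> h; have := cvg_comp _ _ h (@cs 0); rewrite s0; apply.
Qed.

End rescaling.

(** * Amicable games decouple *)

Section profiles.
Variables (R : realType) (n : nat) (dim : 'I_n -> nat).
Implicit Types s : profile R dim.

Lemma replace_same s i x : replace s i x i = x.
Proof. exact: dfwith_in. Qed.

Lemma replace_other s i x j : i != j -> replace s i x j = s j.
Proof. exact: dfwith_out. Qed.

Lemma replace_id s i : replace s i (s i) = s.
Proof.
by apply/functional_extensionality_dep => j; rewrite /replace; case: dfwithP.
Qed.

Lemma replace_replace s i x y : replace (replace s i x) i y = replace s i y.
Proof.
apply/functional_extensionality_dep => j; have [<-|ij] := eqVneq i j.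
  by rewrite !replace_same.
by rewrite !replace_other.
Qed.

Lemma profile_dist_le_sum s s' : profile_dist s s' <= \sum_i norm2 (s i - s' i).
Proof. by apply: sqrt_sum_sqr_le => i; exact: norm2_ge0. Qed.

Lemma norm2_le_profile_dist s s' i : norm2 (s i - s' i) <= profile_dist s s'.
Proof.
rewrite -[leLHS](ger0_norm (norm2_ge0 _)) -sqrtr_sqr ler_wsqrtr// (bigD1 i)//=.
by rewrite lerDl sumr_ge0// => j _; rewrite sqr_ge0.
Qed.

End profiles.

Section decoupling.
Variables (R : realType) (n m : nat) (dim : 'I_n -> nat) (G : dr_game R m dim).
Implicit Types s : profile R dim.

Lemma strat_segment i : segment_closed (strat G i).
Proof.
move=> x y l Sx Sy l0 l1.
have /(_ y x (Itv01 l0 l1)) := @strat_convex _ _ _ _ G i.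
move=> /(_ (mem_set Sy) (mem_set Sx)) /set_mem; congr (strat G i _).
rewrite /conv /=.
apply/rowP => j; rewrite !mxE /= /unstable.onem; ring.
Qed.

Lemma strategies_replace s i x : strategies G s -> strat G i x ->
  strategies G (replace s i x).
Proof.
move=> Ss Sx j; have [<-|ij] := eqVneq i j; first by rewrite replace_same.
by rewrite replace_other.
Qed.

(** The effect of the move of the others from [s] to [s'] on the gain of player
    [i] from switching [x] to [y]. *)
Definition interaction i s s' x y :=
  util_dr G i (replace s' i y) - util_dr G i (replace s' i x) -
  (util_dr G i (replace s i y) - util_dr G i (replace s i x)).

Definition midpoint k (x y : 'rV[R]_k) := x + 2^-1 *: (y - x).

Lemma midpoint_l k (x y : 'rV[R]_k) :
  norm2 (midpoint x y - x) = 2^-1 * norm2 (y - x).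
Proof. by rewrite addrAC subrr add0r norm2Z ger0_norm. Qed.

Lemma midpoint_r k (x y : 'rV[R]_k) :
  norm2 (y - midpoint x y) = 2^-1 * norm2 (y - x).
Proof.
rewrite (_ : y - _ = 2^-1 *: (y - x)) ?norm2Z ?ger0_norm//.
by apply/rowP => j; rewrite !mxE; lra.
Qed.

Lemma strat_midpoint i x y : strat G i x -> strat G i y ->
  strat G i (midpoint x y).
Proof. by move=> Sx Sy; apply: strat_segment => //; lra. Qed.

Variables (c d : 'I_n -> R).
Hypothesis amic : amicable_supergradients G d c.

(** The supergradient [zeta1] cancels from the amicability condition. *)
Lemma interaction_local i s s' (x y : 'rV_(dim i)) :
  strategies G s -> strategies G s' ->
  strat G i x -> strat G i y ->
  profile_dist (replace s i x) (replace s' i y) <= d i ->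
  interaction s s' x y <= c i * norm2 (y - x) ^+ 2.
Proof.
move=> Ss Ss' Sx Sy near; have [_ am] := amic i.
have [z1 [z2 [z3 []]]] := am _ _ (strategies_replace Ss Sx)
  (strategies_replace Ss' Sy) near.
rewrite /own_supergradients !replace_same => _.
move=> /(_ y (strat_dom Sy)) + /(_ x (strat_dom Sx)).
rewrite /interaction !replace_replace -(opprB y x) dotNr !dotDl !dotNl.
move: (util_dr G i) => u; lra.
Qed.

Lemma interaction_split i s s' r (x y w : 'rV_(dim i)) : interaction s s' x y =
  interaction s r x w + interaction s r w y +
  (interaction r s' x w + interaction r s' w y).
Proof. by rewrite /interaction; move: (util_dr G i) => u; ring. Qed.

(** Bisecting both the segment of actions and the segment of profiles divides
    the interaction into four parts and each bound by four. *)
Lemma interaction_global i s s' (x y : 'rV_(dim i)) :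
  strategies G s -> strategies G s' -> strat G i x -> strat G i y ->
  interaction s s' x y <= c i * norm2 (y - x) ^+ 2.
Proof.
have di0 : 0 < d i by have [] := amic i.
have n0 : (0 < n)%N by exact: leq_ltn_trans (ltn_ord i).
(* Profiles with all coordinates within [r] are within [d i] of each other. *)
pose r := d i / n%:R; have r0 : 0 < r by rewrite divr_gt0// ltr0n.
pose M := \sum_j norm2 (s j - s' j) + norm2 (x - y).
have [k Mk] := exists_le_pow2 (M / r).
have {}Mk : M <= r * 2 ^+ k by rewrite mulrC -ler_pdivrMr.
have sM j : norm2 (s j - s' j) <= r * 2 ^+ k.
  apply: le_trans Mk.
  rewrite /M (bigD1 j)//= -addrA lerDl addr_ge0 ?norm2_ge0//.
  by apply: sumr_ge0 => l _; exact: norm2_ge0.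
have xyM : norm2 (x - y) <= r * 2 ^+ k.
  by apply: le_trans Mk; rewrite lerDr sumr_ge0// => l _; exact: norm2_ge0.
elim: k s s' x y {M Mk} sM xyM => [|k IH] s s' x y sM xyM Ss Ss' Sx Sy.
  rewrite expr0 mulr1 in sM xyM.
  apply: interaction_local => //; apply: le_trans (profile_dist_le_sum _ _) _.
  apply: (@le_trans _ _ (\sum_(j < n) r)); last first.
    by rewrite sumr_const card_ord -(mulr_natr r) divfK// pnatr_eq0 -lt0n.
  apply: ler_sum => j _; have [<-|ij] := eqVneq i j.
    by rewrite !replace_same.
  by rewrite !replace_other.
pose q : profile R dim := fun j => midpoint (s j) (s' j).
have Sq : strategies G q by move=> j; exact: strat_midpoint.
have halfk (t : R) : t <= r * 2 ^+ k.+1 -> 2^-1 * t <= r * 2 ^+ k.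
  by rewrite exprS; lra.
have sq j : norm2 (s j - q j) <= r * 2 ^+ k.
  by rewrite norm2B midpoint_l norm2B halfk.
have qs j : norm2 (q j - s' j) <= r * 2 ^+ k.
  by rewrite norm2B midpoint_r norm2B halfk.
have Sw := strat_midpoint Sx Sy.
have xw : norm2 (x - midpoint x y) <= r * 2 ^+ k.
  by rewrite norm2B midpoint_l norm2B halfk.
have wy : norm2 (midpoint x y - y) <= r * 2 ^+ k.
  by rewrite norm2B midpoint_r norm2B halfk.
rewrite (interaction_split s s' q x y (midpoint x y)).
have := IH _ _ _ _ sq xw Ss Sq Sx Sw; have := IH _ _ _ _ sq wy Ss Sq Sw Sy.
have := IH _ _ _ _ qs xw Sq Ss' Sx Sw; have := IH _ _ _ _ qs wy Sq Ss' Sw Sy.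
rewrite midpoint_l midpoint_r !exprMn; move: (@interaction i) => I; lra.
Qed.

(** Bisecting the segment of actions alone halves the bound, while the
    interaction is additive: it must be nonpositive, and it is antisymmetric. *)
Lemma decoupling i s s' (x y : 'rV_(dim i)) :
  strategies G s -> strategies G s' ->
  strat G i x -> strat G i y ->
  util_dr G i (replace s' i y) - util_dr G i (replace s' i x) =
  util_dr G i (replace s i y) - util_dr G i (replace s i x).
Proof.
move=> Ss Ss'; suff H : forall x y, strat G i x -> strat G i y ->
    interaction s s' x y <= 0.
  move=> Sx Sy; have := H _ _ Sx Sy; have := H _ _ Sy Sx.
  by rewrite /interaction; move: (util_dr G i) => u; lra.
move=> {}x {}y Sx Sy.
apply: (@le0_of_le_pow2 _ _ (c i * norm2 (y - x) ^+ 2)) => k.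
elim: k x y Sx Sy => [|k IH] x y Sx Sy.
  by rewrite expr0 divr1; exact: interaction_global.
have Sw := strat_midpoint Sx Sy.
have -> : interaction s s' x y = interaction s s' x (midpoint x y) +
    interaction s s' (midpoint x y) y.
  by rewrite /interaction; move: (util_dr G i) => u; ring.
have := IH _ _ Sx Sw; have := IH _ _ Sw Sy.
rewrite midpoint_l midpoint_r !exprMn (exprS _ k) invfM.
move: (@interaction i) ((2 ^+ k)^-1) => I p; lra.
Qed.

Variables (B : 'I_n -> R) (s0 : profile R dim).
Hypotheses (bnd : bounded_supergradients G B) (Ss0 : strategies G s0).

(** On the strategy set, another reference profile [s0] changes this function by
    a constant only. *)
Definition own_payoff i x := util_dr G i (replace s0 i x).
Arguments own_payoff : clear implicits.

Lemma own_payoffE i s x y : strategies G s -> strat G i x -> strat G i y ->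
  util_dr G i (replace s i y) - util_dr G i (replace s i x) =
  own_payoff i y - own_payoff i x.
Proof. by move=> Ss Sx Sy; exact: decoupling. Qed.

Lemma own_payoff_supergradient i s z : strategies G s ->
  own_supergradients G s (s i) z ->
  supergradients (strat G i) (own_payoff i) (s i) z.
Proof.
move=> Ss sz y Sy; have := sz y (strat_dom Sy).
have := own_payoffE Ss (Ss i) Sy; rewrite replace_id.
by move: (own_payoff i) (util_dr G i) => F u; lra.
Qed.

(** Amicability between two profiles that differ in the action of [i] only. *)
Lemma own_payoff_smooth i :
  smooth_concave (strat G i) (own_payoff i) (B i) (Num.max (c i) 0) (d i).
Proof.
move=> x y Sx Sy xy; have [di0 am] := amic i.
have Ssx := strategies_replace Ss0 Sx; have Ssy := strategies_replace Ss0 Sy.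
have [|z1 [z2 [z3 [_ h2 h3 h]]]] := am _ _ Ssx Ssy.
  apply: le_trans (profile_dist_le_sum _ _) _.
  rewrite (bigD1 i)//= !replace_same big1 ?addr0 1?norm2B// => j ji.
  by rewrite !replace_other 1?eq_sym// subrr norm2_0.
rewrite /own_supergradients !replace_same in h2 h3 h.
have eqy w : replace (replace s0 i w) i = replace s0 i.
  by apply/funext => u; rewrite replace_replace.
have h3' : own_supergradients G (replace s0 i y) (replace s0 i y i) z3.
  by rewrite /own_supergradients replace_same eqy; rewrite eqy in h3.
have h2' : own_supergradients G (replace s0 i x) (replace s0 i x i) z2.
  by rewrite /own_supergradients replace_same eqy; rewrite eqy in h2.
exists z2, z3; split.
- by have := own_payoff_supergradient Ssx h2'; rewrite replace_same.
- by have := own_payoff_supergradient Ssy h3'; rewrite replace_same.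
- exact: bnd h3'.
- apply: (@le_trans _ _ (c i * norm2 (y - x) ^+ 2)).
    by move: h; rewrite !dotDl !dotNl; lra.
  by rewrite ler_wpM2r ?sqr_ge0// le_max lexx.
Qed.

Lemma nashP s : nash G s <-> strategies G s /\
  forall i x, strat G i x -> own_payoff i x <= own_payoff i (s i).
Proof.
have E u i x : strategies G u -> strat G i x ->
    (util_dr G i (replace u i x) <= util_dr G i u) =
    (own_payoff i x <= own_payoff i (u i)).
  move=> Su Sx; have := own_payoffE Su (Su i) Sx; rewrite replace_id.
  move: (own_payoff i) (util_dr G i) => F v h.
  by rewrite -subr_le0 h subr_le0.
split=> -[Ss H]; split; [exact: Ss| |exact: Ss|] => i x Sx.
  rewrite -(E _ _ _ Ss Sx); exact: H.
rewrite (E _ _ _ Ss Sx); exact: H.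
Qed.

End decoupling.

Arguments own_payoff {R n m dim} G s0 i x.

(** * Distance to equilibrium *)

Section equilibria.
Variables (R : realType) (n m : nat) (dim : 'I_n -> nat) (G : dr_game R m dim).
Implicit Types s : profile R dim.

Lemma norm2_le_diameter i (x y : 'rV[R]_(dim i)) :
  strat G i x -> strat G i y -> norm2 (x - y) <= diameter (strat G i).
Proof.
move=> Sx Sy; have [M SM] := compact_norm2_bounded (@strat_compact _ _ _ _ G i).
apply: ub_le_sup; last by exists (x, y).
exists (2 * M) => _ [[a b] [/= Sa Sb] <-].
have nM : norm2 (a - b) ^+ 2 <= (2 * M) ^+ 2.
  rewrite sqr_norm2 !(dotDl, dotDr, dotNl, dotNr) -!sqr_norm2 (dotC b a).
  have := dot_geN a b; have := SM _ Sa; have := SM _ Sb.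
  have := norm2_ge0 a; have := norm2_ge0 b; nra.
have M0 : 0 <= M by apply: le_trans (norm2_ge0 a) (SM _ Sa).
by rewrite -ler_sqr ?nnegrE ?norm2_ge0 ?mulr_ge0.
Qed.

Lemma diameter_ge0 i : 0 <= diameter (strat G i).
Proof.
have [x Sx] := @strat_neq0 _ _ _ _ G i.
exact: le_trans (norm2_ge0 _) (norm2_le_diameter Sx Sx).
Qed.

Lemma dist_nash_le s s' : nash G s' -> dist_nash G s <= profile_dist s s'.
Proof.
move=> Ns'; apply: ge_inf; last by exists s'.
by exists 0 => _ [r _ <-]; exact: sqrtr_ge0.
Qed.

Lemma le_dist_nash s (y : R) : nash G !=set0 ->
  (forall s', nash G s' -> y <= profile_dist s s') -> y <= dist_nash G s.
Proof.
move=> [s' Ns'] H; apply: lb_le_inf; first by exists (profile_dist s s'), s'.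
by move=> _ [r Nr <-]; exact: H.
Qed.

Variables (B c d : 'I_n -> R) (s0 xs : profile R dim).
Hypotheses (bnd : bounded_supergradients G B).
Hypotheses (amic : amicable_supergradients G d c).
Hypotheses (Ss0 : strategies G s0) (Sxs : strategies G xs).
Hypothesis xs_max : forall i x, strat G i x ->
  own_payoff G s0 i x <= own_payoff G s0 i (xs i).

Lemma maximizers_nash : nash G xs.
Proof. exact/(nashP amic Ss0). Qed.

Definition total_gap s :=
  \sum_i (own_payoff G s0 i (xs i) - own_payoff G s0 i (s i)).

Lemma gap_ge0 s i : strategies G s ->
  0 <= own_payoff G s0 i (xs i) - own_payoff G s0 i (s i).
Proof. by move=> Ss; rewrite subr_ge0 xs_max. Qed.

Lemma gap_le_total s i : strategies G s ->
  own_payoff G s0 i (xs i) - own_payoff G s0 i (s i) <= total_gap s.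
Proof.
move=> Ss; rewrite /total_gap (bigD1 i)//= lerDl.
by apply: sumr_ge0 => j _; exact: gap_ge0.
Qed.

Lemma own_payoff_lipschitz i x y : strat G i x -> strat G i y ->
  own_payoff G s0 i x - own_payoff G s0 i y <= B i * norm2 (x - y).
Proof.
have [di0 _] := amic i.
exact: lipschitz_concave (own_payoff_smooth amic bnd Ss0 (i := i)) di0 _ _.
Qed.

Lemma total_gap_le_dist s : (forall i, 0 <= B i) -> strategies G s ->
  total_gap s <= (\sum_i B i + 1) * dist_nash G s.
Proof.
move=> B0 Ss; have b0 : 0 < \sum_i B i + 1 by rewrite ltr_wpDl// sumr_ge0.
rewrite -ler_pdivrMl//; apply: le_dist_nash; 
  first by exists xs; exact: maximizers_nash.
move=> s' /(nashP amic Ss0)[Ss' s'max]; rewrite ler_pdivrMl//.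
apply: (@le_trans _ _ ((\sum_i B i) * profile_dist s s')); last first.
  by rewrite ler_wpM2r ?sqrtr_ge0// lerDl.
rewrite mulr_suml; apply: ler_sum => i _.
apply: (@le_trans _ _ (B i * norm2 (s i - s' i))); last first.
  by rewrite ler_wpM2l// norm2_le_profile_dist.
rewrite norm2B; apply: le_trans (own_payoff_lipschitz (Ss' i) (Ss i)).
by rewrite lerD2r s'max.
Qed.

(** Equilibria being products of individual maximizers, it suffices to find a
    maximizer close to the action of each player. *)
Lemma dist_nash_gain : (0 < n)%N -> exists sigma : R -> R,
  [/\ continuous sigma, class_K sigma &
      forall s, strategies G s -> dist_nash G s <= sigma (total_gap s)].
Proof.
move=> n0; apply: (@class_K_majorant _ _ (strategies G) (dist_nash G) total_gap
    (\sum_i diameter (strat G i))).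
- by move=> s Ss; apply: sumr_ge0 => i _; exact: gap_ge0.
- move=> s Ss; apply: le_trans (dist_nash_le _ maximizers_nash) _.
  apply: le_trans (profile_dist_le_sum _ _) _; apply: ler_sum => i _.
  exact: norm2_le_diameter.
move=> e e0; have en0 : 0 < e / n%:R by rewrite divr_gt0// ltr0n.
have near i := near_maximizer (@strat_compact _ _ _ _ G i)
  (@own_payoff_lipschitz i) (Sxs i) (@xs_max i) en0.
have /choice[r rP] : forall i, exists r : R, 0 < r /\ forall x, strat G i x ->
    own_payoff G s0 i (xs i) - own_payoff G s0 i x <= r ->
    exists y, [/\ strat G i y, own_payoff G s0 i y = own_payoff G s0 i (xs i) &
                  norm2 (x - y) <= e / n%:R].
  by move=> i; have [r r0 H] := near i; exists r.
exists (\big[Num.min/1]_i r i).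
  by apply: lt_bigmin => // i _; have [] := rP i.
move=> s Ss sr.
have near_s i : exists y, [/\ strat G i y,
    own_payoff G s0 i y = own_payoff G s0 i (xs i) &
    norm2 (s i - y) <= e / n%:R].
  have [_] := rP i; apply; first exact: Ss.
  apply: le_trans (gap_le_total i Ss) _; apply: le_trans sr _.
  exact: bigmin_le_cond.
pose y : profile R dim := fun i => sval (cid (near_s i)).
have yP i := svalP (cid (near_s i)).
have Ny : nash G y.
  apply/(nashP amic Ss0); split; first by move=> i; have [] := yP i.
  by move=> i x Sx; have [_ -> _] := yP i; exact: xs_max.
apply: le_trans (dist_nash_le _ Ny) _.
apply: le_trans (profile_dist_le_sum _ _) _.
apply: (@le_trans _ _ (\sum_(i < n) e / n%:R)).
  by apply: ler_sum => i _; have [] := yP i.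
by rewrite sumr_const card_ord -(mulr_natr (e / _)) divfK// pnatr_eq0 -lt0n.
Qed.

End equilibria.

(** * Practical stability of the dynamics *)

Lemma step_gainD (R : realType) : step_gain (fun x y : R => x + y).
Proof.
have c : continuous (fun p : R * R => p.1 + p.2).
  by move=> p; apply: cvgD; [exact: cvg_fst|exact: cvg_snd].
split.
- move=> [x y] [/=]; rewrite !in_itv /= andbT => /andP[x0 _] y0.
  exact: addr_ge0.
- exact: continuous_subspaceT.
- by move=> x x' y _ _ xx; rewrite ltrD2r.
- by move=> x y y' _ _ yy; rewrite ltrD2l.
- apply: cvg_within_filter; have := c (0, 0).
  by rewrite /continuous_at /= addr0.
Qed.

Lemma le_sup_range (R : realType) (n : nat) (f : 'I_n -> R) i :
  f i <= sup (range f).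
Proof.
apply: ub_le_sup; last by exists i.
exists (\sum_j `|f j|) => _ [j _ <-]; rewrite (bigD1 j)//=.
by apply: le_trans (ler_norm _) _; rewrite lerDl sumr_ge0.
Qed.

Lemma inf_range_le (R : realType) (n : nat) (f : 'I_n -> R) i :
  (forall j, 0 < f j) -> inf (range f) <= f i.
Proof.
move=> f0; apply: ge_inf; last by exists i.
by exists 0 => _ [j _ <-]; exact: ltW.
Qed.

(** Covers the momentum weight [1 / (lambda mu)] plus the curvature, times
    [D^2], and the loss of an irreversible move; the absolute values make it
    nonnegative for all arguments. *)
Definition gain_bound (R : realType) (n : nat) (D B c varrho : 'I_n -> R) i
    : R :=
  (`|varrho i| + 1) * (`|c i| + 1) * D i ^+ 2 + 2 * `|B i| * `|D i|.

Lemma gain_bound_ge0 (R : realType) (n : nat) (D B c varrho : 'I_n -> R) i :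
  0 <= gain_bound D B c varrho i.
Proof.
apply: addr_ge0; last by rewrite !mulr_ge0.
by apply: mulr_ge0; [rewrite mulr_ge0 ?addr_ge0|exact: sqr_ge0].
Qed.

Section trajectories.
Variables (R : realType) (n m : nat) (dim : 'I_n -> nat) (G : dr_game R m dim).
Variables (B c d mu alpha varrho lambda : 'I_n -> R).
Let D i := diameter (strat G i).
Hypotheses (B0 : forall i, 0 <= B i) (bnd : bounded_supergradients G B).
Hypothesis amic : amicable_supergradients G d c.
Hypothesis mu0 : forall i, 0 < mu i.
Hypothesis alphaP : forall i, [/\ 0 < alpha i, alpha i <= 2^-1 &
  0 < D i -> alpha i <= inf (range d) / D i].
Hypothesis varrho1 : forall i, 1 < varrho i.
Hypothesis lambdaP : forall i, if 0 < c i
  then (varrho i * mu i * c i)^-1 < lambda i < (mu i * c i)^-1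
  else (varrho i * mu i)^-1 < lambda i.

(** The lower limit on [lambda] is inversely proportional to [mu], hence the
    bound does not involve [mu]. *)
Lemma momentum_weight i : 0 < lambda i /\
  (lambda i * mu i)^-1 + Num.max (c i) 0 <= (`|varrho i| + 1) * (`|c i| + 1).
Proof.
have v0 : 0 < varrho i by apply: lt_trans (varrho1 i).
have m0 := mu0 i.
have vm0 : 0 < varrho i * mu i by rewrite mulr_gt0.
rewrite (gtr0_norm v0).
have := lambdaP i; case: ltP => [c0 /andP[la _]|c0 la].
  have la0 : 0 < lambda i.
    by apply: lt_trans la; rewrite invr_gt0 mulr_gt0.
  split => //; rewrite (gtr0_norm c0).
  have : (lambda i * mu i)^-1 <= varrho i * c i.
    rewrite -ler_pV2 ?invrK ?inE ?unitfE ?gt_eqF ?invr_gt0 ?mulr_gt0//=.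
    rewrite -ler_pdivrMr// -invfM mulrAC.
    exact: ltW.
  have := varrho1 i; nra.
have la0 : 0 < lambda i by apply: lt_trans la; rewrite invr_gt0.
split => //; have c1 := normr_ge0 (c i).
have : (lambda i * mu i)^-1 <= varrho i.
  rewrite -ler_pV2 ?invrK ?inE ?unitfE ?gt_eqF ?invr_gt0 ?mulr_gt0//=.
  by rewrite -ler_pdivrMr// -invfM ltW.
by have := varrho1 i; nra.
Qed.

Variables (pi : forall i, 'rV[R]_(dim i) -> 'rV[R]_(dim i))
  (v : forall i, profile R dim -> 'rV[R]_(dim i)) (s : nat -> profile R dim).
Hypotheses (piP : argmax_selection G pi) (vP : steepest_selection G v).
Hypothesis sP : trajectory G alpha mu lambda pi v s.

Let phi i t := mu i *: v i (s t) - (lambda i)^-1 *: (s t i - s t.-1 i).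

Let s_step i t : s t.+1 i = s t i + alpha i *: (@pi i (phi i t) - s t i).
Proof. by have [_ ->] := sP. Qed.

Let alpha0 i : 0 < alpha i. Proof. by have [] := alphaP i. Qed.

Let alpha1 i : alpha i < 1.
Proof. by have [_ h _] := alphaP i; apply: le_lt_trans h _; lra. Qed.

Lemma trajectory_in t : strategies G (s t).
Proof.
move=> i; have [s0 _] := sP.
apply: (averaging_in (@strat_segment _ _ _ _ G i) (alpha0 i) (alpha1 i)
  (s := fun t => s t i) (p := fun t => @pi i (phi i t))) => // u.
by have [] := @piP i (phi i u).
Qed.

Let D0 i : 0 <= D i := diameter_ge0 G i.

Lemma step_size i : alpha i * D i <= d i.
Proof.
have d0 j : 0 < d j by have [] := amic j.
have [_ _ h] := alphaP i; have := D0 i; rewrite le_eqVlt => /predU1P[<-|Di].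
  by rewrite mulr0 ltW.
rewrite -ler_pdivlMr//; apply: le_trans (h Di) _.
by rewrite ler_pM2r ?invr_gt0//; exact: inf_range_le.
Qed.

Lemma last_move_le i t : norm2 (s t i - s t.-1 i) <= alpha i * D i.
Proof.
have aD : 0 <= alpha i * D i by rewrite mulr_ge0// ltW.
case: t => [|t]; first by rewrite subrr norm2_0.
rewrite /= s_step addrAC subrr add0r norm2Z gtr0_norm// ler_pM2l//.
by apply: norm2_le_diameter; [have [] := @piP i (phi i t)|exact: trajectory_in].
Qed.

Variables (s0 xs : profile R dim).
Hypotheses (Ss0 : strategies G s0) (Sxs : strategies G xs).
Hypothesis xs_max : forall i x, strat G i x ->
  own_payoff G s0 i x <= own_payoff G s0 i (xs i).

Lemma player_gap_bound i t :
  own_payoff G s0 i (xs i) - own_payoff G s0 i (s t i) <=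
  (1 - alpha i) ^+ t *
    (own_payoff G s0 i (xs i) - own_payoff G s0 i (s 0%N i)) +
  alpha i * ((1 + (dim i)%:R) * gain_bound D B c varrho i).
Proof.
have [la0 kap] := momentum_weight i.
have di0 : 0 < d i by have [] := amic i.
have pS u : strat G i (@pi i (phi i u)) by have [] := @piP i (phi i u).
have k0 : 0 <= (lambda i * mu i)^-1 by rewrite invr_ge0 mulr_ge0// ltW.
have c0 : 0 <= Num.max (c i) 0 by rewrite le_max lexx orbT.
have H := @frank_wolfe_rate R (dim i) (strat G i) (own_payoff G s0 i)
  (B i) (Num.max (c i) 0) (d i) (D i) (alpha i) (lambda i * mu i)^-1
  (fun u => @pi i (phi i u)) (fun u => s u i) (fun u => v i (s u)) (xs i)
  (@strat_segment _ _ _ _ G i) (own_payoff_smooth amic bnd Ss0 (i := i)) di0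
  (B0 i) c0 k0 (alpha0 i) (alpha1 i) (step_size i)
  (@norm2_le_diameter _ _ _ _ G i) (trajectory_in 0 i) pS (Sxs i) (s_step i).
apply: le_trans (H _ _ t) _.
- move=> u; apply: (own_payoff_supergradient amic Ss0 (trajectory_in u)).
  by have [z [[]]] := vP i (trajectory_in u).
- move=> u; apply: (momentum_near_best (S := strat G i)
    (delta := s u i - s u.-1 i)) => //.
  + by move=> y Sy; have [_] := @piP i (phi i u); apply.
  + exact: last_move_le.
  + exact: norm2_le_diameter.
rewrite lerD2l ler_pM2l// /gain_bound (ger0_norm (B0 i)) (ger0_norm (D0 i)).
have D2 := ler_wpM2r (sqr_ge0 (D i)) kap.
have BD : 0 <= 2 * B i * D i by rewrite !mulr_ge0.
have X0 : 0 <= (`|varrho i| + 1) * (`|c i| + 1) * D i ^+ 2.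
  by rewrite !mulr_ge0 ?addr_ge0 ?sqr_ge0.
have dX := mulr_ge0 (ler0n R (dim i)) X0.
lra.
Qed.

Lemma total_gap_bound a t : (forall i, a <= alpha i) ->
  total_gap G s0 xs (s t) <= (1 - a) ^+ t * total_gap G s0 xs (s 0%N) +
  sup (range alpha) *
    ((1 + \sum_i (dim i)%:R) * \sum_i gain_bound D B c varrho i).
Proof.
move=> aa; apply: (@le_trans _ _ (\sum_i ((1 - a) ^+ t *
    (own_payoff G s0 i (xs i) - own_payoff G s0 i (s 0%N i)) +
    sup (range alpha) * ((1 + \sum_j (dim j)%:R) *
      gain_bound D B c varrho i)))).
  apply: ler_sum => i _; apply: le_trans (player_gap_bound i t) _.
  apply: lerD.
    apply: ler_wpM2r; first exact: (gap_ge0 xs_max i (trajectory_in 0)).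
    rewrite lerXn2r ?nnegrE ?lerD2l ?lerN2// subr_ge0 ?ltW//.
    exact: le_lt_trans (aa i) _.
  have e0 : 0 <= 1 + (dim i)%:R :> R by rewrite addr_ge0.
  apply: ler_pM; rewrite ?mulr_ge0 ?gain_bound_ge0 ?(ltW (alpha0 i))//.
    exact: le_sup_range.
  rewrite ler_wpM2r ?gain_bound_ge0// lerD2l (bigD1 i)//= lerDl.
  exact: sumr_ge0.
by rewrite big_split /= -!mulr_sumr.
Qed.

End trajectories.

(** The part of the theorem that concerns a game with amicable and bounded
    supergradients; the gains are built from the game alone, through one choice
    of factors, and serve for all others. *)
Lemma practical_stability (R : realType) (n m : nat) (dim : 'I_n -> nat)
    (G : dr_game R m dim) (B0 c0 d0 : 'I_n -> R) : (0 < n)%N ->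
  bounded_supergradients G B0 -> amicable_supergradients G d0 c0 ->
  let D := fun i : 'I_n => diameter (strat G i) in
  exists gamma : R -> R, class_K gamma /\
  forall B c d : 'I_n -> R,
  (forall i, 0 <= B i) ->
  bounded_supergradients G B ->
  amicable_supergradients G d c ->
  forall mu alpha varrho lambda : 'I_n -> R,
  (forall i, 0 < mu i) ->
  (forall i, [/\ 0 < alpha i, alpha i <= 2^-1 &
     0 < D i -> alpha i <= inf (range d) / D i]) ->
  (forall i, 1 < varrho i) ->
  (forall i, if 0 < c i
     then (varrho i * mu i * c i)^-1 < lambda i < (mu i * c i)^-1
     else (varrho i * mu i)^-1 < lambda i) ->
  exists beta : R -> R -> R, class_KL beta /\
  forall (pi : forall i, 'rV[R]_(dim i) -> 'rV[R]_(dim i))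
    (v : forall i, profile R dim -> 'rV[R]_(dim i))
    (s : nat -> profile R dim),
  argmax_selection G pi ->
  steepest_selection G v ->
  trajectory G alpha mu lambda pi v s ->
  forall t : nat,
    dist_nash G (s t) <=
    Num.max (beta (dist_nash G (s 0%N)) t%:R)
      (gamma ((\sum_i gain_bound D B c varrho i) *
                (sup (range alpha) + sup (range mu)))).
Proof.
move=> n0 bnd0 amic0 D.
have i0 := Ordinal n0.
pose s0 : profile R dim := fun i => sval (cid (@strat_neq0 _ _ _ _ G i)).
have Ss0 : strategies G s0.
  by move=> i; exact: svalP (cid (@strat_neq0 _ _ _ _ G i)).
have ex i : exists x, strat G i x /\
    forall y, strat G i y -> own_payoff G s0 i y <= own_payoff G s0 i x.
  have [x Sx H] := maximizer_exists (@strat_neq0 _ _ _ _ G i)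
    (@strat_compact _ _ _ _ G i) (own_payoff_lipschitz bnd0 amic0 Ss0 (i := i)).
  by exists x.
pose xs : profile R dim := fun i => sval (cid (ex i)).
have xsP i := svalP (cid (ex i)).
have Sxs : strategies G xs by move=> i; have [] := xsP i.
have xs_max i x :
    strat G i x -> own_payoff G s0 i x <= own_payoff G s0 i (xs i).
  by have [_] := xsP i; apply.
have [sigma [cs Ks sigmaP]] := dist_nash_gain bnd0 amic0 Ss0 Sxs xs_max n0.
pose e : R := 1 + \sum_i (dim i)%:R.
have e1 : 1 <= e by rewrite lerDl sumr_ge0.
have e0 : 0 < e by exact: lt_le_trans e1.
exists (fun r => sigma (2 * e * r)); split.
  by apply: class_K_rescale; rewrite // mulr_gt0.
move=> B c d B_ge0 bnd amic mu alpha varrho lambda mu0 alphaP varrho1 lambdaP.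
pose a := \big[Num.min/2^-1]_i alpha i.
have a0 : 0 < a by apply: lt_bigmin => // i _; have [] := alphaP i.
have a1 : a <= 2^-1 by exact: bigmin_le_id.
have a1' : 0 < 1 - a by rewrite subr_gt0; apply: le_lt_trans a1 _; lra.
have aa i : a <= alpha i by exact: bigmin_le_cond.
pose b := \sum_i B i + 1.
have b0 : 0 < b by rewrite ltr_wpDl// sumr_ge0.
exists (fun x y => sigma (2 * b * (x * (1 - a) `^ y))); split.
  by apply: class_KL_geometric => //; rewrite ?mulr_gt0// gtrBl.
move=> pi v s piP vP sP t.
have Ss := trajectory_in alphaP piP sP.
have St := total_gap_bound B_ge0 bnd amic mu0 alphaP varrho1 lambdaP piP vP sP
  Ss0 Sxs xs_max t aa.
apply: le_trans (sigmaP _ (Ss t)) _.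
set A := sup (range alpha) in St *; set M := sup (range mu).
set K := \sum_i gain_bound _ _ _ _ i in St *.
have K0 : 0 <= K by apply: sumr_ge0 => i _; exact: gain_bound_ge0.
have A0 : 0 <= A.
  by apply: le_trans (le_sup_range alpha i0); have [/ltW] := alphaP i0.
have M0 : 0 <= M by apply: le_trans (le_sup_range mu i0); exact: ltW.
have H0 : 0 <= total_gap G s0 xs (s t).
  by apply: sumr_ge0 => i _; exact: (gap_ge0 xs_max i (Ss t)).
have Sb := total_gap_le_dist bnd amic Ss0 Sxs xs_max B_ge0 (Ss 0%N).
rewrite le_max powR_mulrn; last exact: ltW.
set q := (1 - a) ^+ t in St *.
have q0 : 0 <= q by rewrite exprn_ge0// ltW.
move: H0 St Sb; set h := total_gap G s0 xs (s t).
set h0 := total_gap G s0 xs (s 0%N); set w := dist_nash G (s 0%N).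
move=> h_ge0 St /(ler_wpM2l q0) Sb.
(* Whichever of the transient and the residual gap dominates, twice it bounds
   the whole. *)
have [le_pr|lt_rp] := leP (q * h0) (A * (e * K)).
  apply/orP; right; apply: (class_K_mono Ks) => //.
  have : 0 <= e * (K * M) by rewrite !mulr_ge0// ltW.
  move: St; rewrite -/e -/K; lra.
apply/orP; left; apply: (class_K_mono Ks) => //.
move: St Sb; rewrite -/e -/K -/b; lra.
Qed.

Theorem theorem29 (R : realType) :
  exists K : forall n : nat,
      ('I_n -> R) -> ('I_n -> R) -> ('I_n -> R) -> ('I_n -> R) -> R,
  (forall (n : nat) (D B c varrho : 'I_n -> R), 0 <= K n D B c varrho) /\
  forall (n m : nat) (dim : 'I_n -> nat) (G : dr_game R m dim),
  (0 < n)%N ->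
  let D := fun i : 'I_n => diameter (strat G i) in
  exists (gamma1 : R -> R) (rho1 : R -> R -> R),
  [/\ class_K gamma1, step_gain rho1 &
  forall B c d : 'I_n -> R,
  (forall i, 0 <= B i) ->
  bounded_supergradients G B ->
  amicable_supergradients G d c ->
  forall mu alpha varrho lambda : 'I_n -> R,
  (forall i, 0 < mu i) ->
  (forall i, [/\ 0 < alpha i, alpha i <= 2^-1 &
     (* d_min / D_i is read as +oo when D_i = 0 *)
     0 < D i -> alpha i <= inf (range d) / D i]) ->
  (forall i, 1 < varrho i) ->
  (forall i, if 0 < c i
     then (varrho i * mu i * c i)^-1 < lambda i < (mu i * c i)^-1
     else (varrho i * mu i)^-1 < lambda i) ->
  exists beta1 : R -> R -> R, class_KL beta1 /\
  forall (pi : forall i, 'rV[R]_(dim i) -> 'rV[R]_(dim i))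
    (v : forall i, profile R dim -> 'rV[R]_(dim i))
    (s : nat -> profile R dim),
  argmax_selection G pi ->
  steepest_selection G v ->
  trajectory G alpha mu lambda pi v s ->
  forall t : nat,
    dist_nash G (s t) <=
    Num.max (beta1 (dist_nash G (s 0%N)) t%:R)
      (gamma1 (K n D B c varrho * rho1 (sup (range alpha)) (sup (range mu))))].
Proof.
exists (fun n D B c varrho => \sum_i gain_bound D B c varrho i); split.
  by move=> n D B c varrho; apply: sumr_ge0 => i _; exact: gain_bound_ge0.
move=> n m dim G n0 D.
have [[B0 [c0 [d0 [bnd0 amic0]]]]|none] := pselect (exists B c d : 'I_n -> R,
    bounded_supergradients G B /\ amicable_supergradients G d c).
  have [gamma [Kg H]] := practical_stability n0 bnd0 amic0.
  exists gamma, (fun x y => x + y); split; [exact: Kg|exact: step_gainD|].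
  move=> B c d B_ge0 bnd amic mu alpha varrho lambda mu0 alphaP varrho1 lambdaP.
  have [beta [KL Hb]] := H B c d B_ge0 bnd amic mu alpha varrho lambda mu0
    alphaP varrho1 lambdaP.
  exists beta; split; first exact: KL.
  move=> pi v s piP vP sP t.
  exact: Hb piP vP sP t.
(* Without admissible factors the estimate is vacuous. *)
exists id, (fun x y => x + y); split; last 1 first.
- by move=> B c d _ bnd amic; case: none; exists B, c, d.
- split => //; first by apply: continuous_subspaceT => x; exact: cvg_id.
- exact: step_gainD.
Qed.
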